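(* Let $\{h_{m,n}\}_{m,n\in\mathbb{Z}^d}\subset\mathcal{S}(\mathbb{R}^d)$ be a painless nonstationary Gabor frame with time sampling steps $a_m$, points $b_m$, and $\varepsilon_m=C_*/a_m$. Let $Q:=(0,1)^d$ and $\mathcal{T}:=\{A_m(\cdot)+c_m\}_{m\in\mathbb{Z}^d}$ with $$A_m:=\Big(2\varepsilon_m+\frac{1}{a_m}\Big)\cdot I_d\quad\text{and}\quad (c_m)_j:=-\varepsilon_m+(b_m)_j,\quad 1\le j\le d,$$ where $I_d$ is the identity on $\mathbb{R}^d$. Then $\mathcal{Q}:=\{T(Q)\}_{T\in\mathcal{T}}$ is a structured covering of $\mathbb{R}^d$.
   Context: $\hat f(\xi)=\int_{\mathbb{R}^d}f(x)e^{-2\pi i x\cdot\xi}\,dx$. $u(\xi):=1+\|\xi\|_2$. $F\asymp G$ means $C_1F\le G\le C_2F$ for constants $0<C_1,C_2<\infty$. A set $\{\xi_i\}$ is $\delta$-separated if $\inf_{j\ne k}\|\xi_j-\xi_k\|_2=\delta>0$. $\|A\|_{\ell^\infty(\mathbb{R}^{d\times d})}:=\max|a_{ij}|$. A non-empty open set $\Omega'$ is compactly contained in an open set $\Omega$ if $\overline{\Omega'}\subset\Omega$ and $\overline{\Omega'}$ is compact. Admissible covering: for a countable family $\mathcal{T}=\{A_k(\cdot)+c_k\}_k$ of invertible affine transformations on $\mathbb{R}^d$ and $Q\subset\mathbb{R}^d$, put $Q_T:=T(Q)$ and $\widetilde T:=\{T'\in\mathcal{T}:Q_{T'}\cap Q_T\ne\emptyset\}$.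 $\{Q_T\}_{T\in\mathcal{T}}$ is an admissible covering if $\bigcup_TQ_T=\mathbb{R}^d$ and there is $n_0\in\mathbb{N}$ with $|\widetilde T|\le n_0$ for all $T$. For $\xi_T\in Q_T$, $\{u(\xi_T)\}_T$ is called a $\mathcal{Q}$-moderate weight if $u$ is $\mathcal{Q}$-moderate: there is $C>0$ with $u(x)\le Cu(y)$ for all $x,y\in Q_T$, all $T\in\mathcal{T}$. Structured covering: $\mathcal{Q}=\{Q_T\}_{T\in\mathcal{T}}$, with $Q$ bounded and open, is a structured covering if there is a bounded open set $P\subset Q$, compactly contained in $Q$, such that (1) $\{P_T\}_{T}$ and $\{Q_T\}_{T}$ (with $P_T:=T(P)$) are admissible coverings; (2) there is $K>0$ with $\|A_{k'}^{-1}A_k\|_{\ell^\infty(\mathbb{R}^{d\times d})}\le K$ whenever $(A_{k'}Q+c_{k'})\cap(A_kQ+c_k)\ne\emptyset$; (3) there is $K_*>0$ with $\|A_k^{-1}\|_{\ell^\infty(\mathbb{R}^{d\times d})}\le K_*$ for all $k$; (4) there is a $\delta$-separated set $\{\xi_T\}_{T\in\mathcal{T}}$ with $\xi_T\in Q_T$ for all $T$ such that $\{\omega_T\}:=\{u(\xi_T)\}$ is a $\mathcal{Q}$-moderate weight; (5) there is $\gamma>0$ with $|Q_T|\le\omega_T^\gamma$ for all $T$. Painless nonstationary Gabor frame (NSGF): Let $h_m\in\mathcal{S}(\mathbb{R}^d)$, $a_m>0$, $b_m\in\mathbb{R}^d$ ($m\in\mathbb{Z}^d$) with $\mathrm{supp}(\hat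 h_m)\subseteq[0,1/a_m]^d+b_m$, and $h_{m,n}(x):=h_m(x-na_m)$ for $m,n\in\mathbb{Z}^d$. Assume $\{h_{m,n}\}$ is a frame for $L^2(\mathbb{R}^d)$: $\sum_{m,n}|\langle f,h_{m,n}\rangle|^2\asymp\|f\|_2^2$ for all $f\in L^2(\mathbb{R}^d)$. For a constant $C_*>0$ set $\varepsilon_m:=C_*/a_m$, $I_m:=(-\varepsilon_m,\frac1{a_m}+\varepsilon_m)^d+b_m$, and $\widetilde m:=\{m'\in\mathbb{Z}^d: I_{m'}\cap I_m\neq\emptyset\}$. The system is a painless NSGF if: (i) $\hat h_m\in C_c^\infty(\mathbb{R}^d)$ for all $m$, and for each $\beta\in\mathbb{N}_0^d$ there is $C_\beta>0$ with $\sup_\xi|\partial^\beta\hat h_m(\xi)|\le C_\beta a_m^{d/2+|\beta|}$ for all $m$; (ii) $a:=\sup_m a_m<\infty$; (iii) there are $C_*>0$ and $n_0\in\mathbb{N}$ such that the cubes $I_m$ satisfy $|\widetilde m|\le n_0$, and $a_{m'}\asymp a_m$ uniformly for all $m$ and all $m'\in\widetilde m$ (this $C_*$ is fixed from now on); (iv) $\{b_m\}$ is a $\delta$-separated set and $\{\omega_m\}:=\{u(b_m)\}$ is an $\{I_m\}$-moderate weight, i.e. there is $C>0$ with $u(x)\le Cu(y)$ for all $x,y\in I_m$ and all $m$; (v) there is $\gamma>0$ with $|I_m|\le\omega_m^\gamma$ for all $m$. With these definitions $\{T(Q)\}_{T\in\mathcal{T}}=\{I_m\}_{m\in\mathbb{Z}^d}$.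 *)

(* Defs.v *)
From HB Require Import structures.
From mathcomp Require Import all_boot all_order all_algebra.
From mathcomp Require Import complex.
From mathcomp Require Import all_classical all_reals all_analysis.

Set Implicit Arguments.
Unset Strict Implicit.
Unset Printing Implicit Defensive.

Import Order.TTheory GRing.Theory Num.Theory.
Import numFieldNormedType.Exports.

Local Open Scope classical_set_scope.
Local Open Scope ring_scope.
Local Open Scope complex_scope.

(* The space R^d is the type 'rV[R]_d. Its topology is the library's (the one
   of the sup norm, hence the Euclidean one). The sigma-algebra below is
   generated by the coordinates, i.e., it is the Borel sigma-algebra. *)

Section measurable_rV.
Context (R : realType) (n : nat).

Let coor (i : 'I_n) (x : 'rV[R]_n) : measurableTypeR R := x ord0 i.

Let rV_set0 : g_sigma_preimage coor set0.
Proof. exact: sigma_algebra0. Qed.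

Let rV_setC A : g_sigma_preimage coor A -> g_sigma_preimage coor (~` A).
Proof. exact: sigma_algebraC. Qed.

Let rV_bigcup (F : (set 'rV[R]_n)^nat) :
  (forall i, g_sigma_preimage coor (F i)) ->
  g_sigma_preimage coor (\bigcup_i (F i)).
Proof. exact: sigma_algebra_bigcup. Qed.

HB.instance Definition _ := @isMeasurable.Build default_measure_display
  'rV[R]_n (g_sigma_preimage coor) rV_set0 rV_setC rV_bigcup.

Lemma measurable_coord (i : 'I_n) :
  measurable_fun [set: 'rV[R]_n]
    ((fun x => x ord0 i) : 'rV[R]_n -> measurableTypeR R).
Proof.
move=> _ Y mY; rewrite setTI; apply: sub_sigma_algebra => /=.
rewrite -bigcup_seq/=; exists i => /=; first by rewrite mem_index_enum.
by exists Y => //; rewrite setTI.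
Qed.

Lemma measurable_fun_rV d (T : measurableType d) (f : T -> 'rV[R]_n) :
  (forall i, measurable_fun [set: T]
     ((fun t => f t ord0 i) : T -> measurableTypeR R)) ->
  measurable_fun [set: T] f.
Proof.
move=> mf _ A mA; rewrite setTI.
pose G : set (set 'rV[R]_n) := image_set_system setT f measurable.
suff : G A by rewrite /G /image_set_system /= setTI.
move: A mA; apply: smallest_sub.
  exact/sigma_algebra_image/sigma_algebra_measurable.
rewrite -bigcup_seq; apply: bigcup_sub => i _ _ [B mB <-].
rewrite /G /image_set_system /= !setTI.
by have := mf i measurableT B mB; rewrite setTI.
Qed.

End measurable_rV.

Section lebesgue_rV.
Context (R : realType).
Local Open Scope ereal_scope.

Definition rV_cons n (p : measurableTypeR R * 'rV[R]_n) : 'rV[R]_n.+1 :=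
  \row_(i < n.+1) if unlift ord0 i is Some j then p.2 ord0 j else p.1.

Lemma measurable_rV_cons n : measurable_fun setT (@rV_cons n).
Proof.
apply: measurable_fun_rV => i.
case: (unliftP ord0 i) => [j ij|i0].
- rewrite (_ : (fun t => _) =
    ((fun x => x ord0 j) : 'rV[R]_n -> measurableTypeR R) \o snd).
    by apply: measurableT_comp => //; exact: measurable_coord.
  by apply/funext => t /=; rewrite mxE ij liftK.
- rewrite (_ : (fun t => _) = fst); first exact: measurable_fst.
  by apply/funext => t /=; rewrite mxE i0 unlift_none.
Qed.

Section step.
Variables (n : nat) (m : {sigma_finite_measure set 'rV[R]_n -> \bar R}).

Definition lebesgue_rV_succ : set 'rV[R]_n.+1 -> \bar R :=
  pushforward (lebesgue_measure \x m) (@rV_cons n).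

Let lr0 : lebesgue_rV_succ set0 = 0.
Proof. by rewrite /lebesgue_rV_succ /pushforward preimage_set0 measure0. Qed.

Let lr_ge0 A : 0 <= lebesgue_rV_succ A.
Proof. by rewrite /lebesgue_rV_succ /pushforward; exact: measure_ge0. Qed.

Let lr_sigma_additive : semi_sigma_additive lebesgue_rV_succ.
Proof.
have mf := @measurable_rV_cons n.
move=> F mF tF mUF; rewrite /lebesgue_rV_succ /pushforward preimage_bigcup.
apply: measure_semi_sigma_additive.
- by move=> k; rewrite -[X in measurable X]setTI; exact: mf.
- apply/trivIsetP => /= i j _ _ ij; rewrite -preimage_setI.
  by move/trivIsetP : tF => /(_ _ _ _ _ ij) ->//; rewrite preimage_set0.
- by rewrite -preimage_bigcup -[X in measurable X]setTI; exact: mf.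
Qed.

HB.instance Definition _ := isMeasure.Build _ _ _ lebesgue_rV_succ
  lr0 lr_ge0 lr_sigma_additive.

Let lr_sigma_finite : sigma_finite setT lebesgue_rV_succ.
Proof.
pose tl (x : 'rV[R]_n.+1) : measurableTypeR R * 'rV[R]_n :=
  (x ord0 ord0, \row_(j < n) x ord0 (lift ord0 j)).
have mtl : measurable_fun setT tl.
  apply/measurable_fun_pairP; split; first exact: measurable_coord.
  apply: measurable_fun_rV => j.
  rewrite (_ : (fun t => _) = fun x : 'rV[R]_n.+1 => x ord0 (lift ord0 j)).
    exact: measurable_coord.
  by apply/funext => x /=; rewrite mxE.
have tlK p : tl (rV_cons p) = p.
  case: p => a v; rewrite /tl /rV_cons mxE unlift_none /=; congr pair.
  by apply/rowP => j; rewrite !mxE liftK.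
have /sigma_finiteP[F [TF ndF Foo]] := sigma_finiteT (@lebesgue_measure R).
have /sigma_finiteP[G [TG ndG Goo]] := sigma_finiteT m.
exists (fun k => tl @^-1` (F k `*` G k)).
  rewrite -preimage_bigcup (_ : \bigcup_k _ = setT) ?preimage_setT//.
  apply/seteqP; split => // -[x y] _.
  have [k _ Fkx] : (\bigcup_k F k) x by rewrite -TF.
  have [l _ Gly] : (\bigcup_k G k) y by rewrite -TG.
  exists (maxn k l) => //; split => /=.
  - by move: x Fkx; exact/subsetPset/ndF/leq_maxl.
  - by move: y Gly; exact/subsetPset/ndG/leq_maxr.
move=> k; have [mF Fk] := Foo k; have [mG Gk] := Goo k; split.
  by rewrite -[X in measurable X]setTI; apply: mtl => //; exact: measurableX.
rewrite /lebesgue_rV_succ /pushforward -comp_preimage.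
rewrite (_ : tl \o _ = id) ?preimage_id; last first.
  by apply/funext => p /=; rewrite tlK.
by rewrite product_measure1E// lte_mul_pinfty// ge0_fin_numE.
Qed.

HB.instance Definition _ := Measure_isSigmaFinite.Build _ _ _ lebesgue_rV_succ
  lr_sigma_finite.

End step.

(* Lebesgue measure on R^d, as an iterated product measure. *)
Fixpoint lebesgue_rV n : {sigma_finite_measure set 'rV[R]_n -> \bar R} :=
  if n is k.+1 then lebesgue_rV_succ (lebesgue_rV k)
  else (\d_(0%R : 'rV[R]_0) : {finite_measure set 'rV[R]_0 -> \bar R}).

Lemma lebesgue_rV_box n (B : 'I_n -> set (measurableTypeR R)) :
  (forall i, measurable (B i)) ->
  lebesgue_rV n [set x : 'rV[R]_n | forall i, B i (x ord0 i)] =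
  \prod_(i < n) lebesgue_measure (B i).
Proof.
elim: n B => [|n IH] B mB.
  by rewrite big_ord0 /= diracE mem_set//= => -[].
rewrite big_ord_recl -IH; last by move=> i; exact: mB.
rewrite /= /lebesgue_rV_succ /pushforward -product_measure1E//.
  congr (_ _); apply/seteqP; split => -[x v] /= H.
    split; first by have := H ord0; rewrite mxE unlift_none.
    by move=> i; have := H (lift ord0 i); rewrite mxE liftK.
  move=> i; case: (unliftP ord0 i) => [j ->|->].
    by rewrite mxE liftK; exact: H.2.
  by rewrite mxE unlift_none; exact: H.1.
rewrite (_ : mkset _ = \big[setI/setT]_(i < n)
  ((fun x : 'rV[R]_n => x ord0 i : measurableTypeR R) @^-1` B (lift ord0 i))).
  apply: bigsetI_measurable => i _; rewrite -[X in measurable X]setTI.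
  exact: measurable_coord.
rewrite -bigcap_seq; apply/seteqP; split => x /= H i //.
  by move=> _; apply: H.
by apply: H; rewrite /= mem_index_enum.
Qed.

End lebesgue_rV.
Arguments lebesgue_rV {R} n.

Section euclidean.
Context (R : realType) (d : nat).
Implicit Types x y xi : 'rV[R]_d.

Definition dot x y : R := \sum_i x ord0 i * y ord0 i.

(* The library's norm `|x| on 'rV[R]_d is the sup norm. *)
Definition norm2 x : R := Num.sqrt (\sum_i x ord0 i ^+ 2).

Definition weight xi : R := 1 + norm2 xi.

Definition delta_separated (I : Type) (D : set I) (delta : R)
    (xi : I -> 'rV[R]_d) : Prop :=
  0 < delta /\
  ereal_inf [set e : \bar R | exists j k,
    [/\ D j, D k, j <> k & e = (norm2 (xi j - xi k))%:E]] = delta%:E.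

Definition compactly_contained (A B : set 'rV[R]_d) : Prop :=
  [/\ A !=set0, open A, open B, closure A `<=` B & compact (closure A)].

End euclidean.

Section complex_functions.
Context (R : realType) (d : nat).
Implicit Types (f g : 'rV[R]_d -> R[i]) (p : 'rV[R]_d -> R).

Definition cmod (z : R[i]) : R := ComplexField.Normc.normc z.

Definition cexpi (t : R) : R[i] := cos t +i* sin t.

(* Integrals and partial derivatives of complex-valued functions are taken on
   real and imaginary parts. *)
Definition cintegral f : R[i] :=
  (\int[lebesgue_rV d]_x complex.Re (f x))%R +i*
  (\int[lebesgue_rV d]_x complex.Im (f x))%R.

Definition fourier f (xi : 'rV[R]_d) : R[i] :=
  cintegral (fun x => f x * cexpi (- (2 * pi * dot x xi))).

Definition partial (i : 'I_d) p : 'rV[R]_d -> R := 'D_(delta_mx ord0 i) p.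

Definition smooth p : Prop :=
  forall s : seq 'I_d,
    continuous (foldr partial p s) /\
    forall i x, derivable (foldr partial p s) x (delta_mx ord0 i).

Definition csmooth f : Prop :=
  smooth (fun x => complex.Re (f x)) /\ smooth (fun x => complex.Im (f x)).

Definition mpartial (beta : {ffun 'I_d -> nat}) p : 'rV[R]_d -> R :=
  foldr (fun i q => iter (beta i) (partial i) q) p (enum 'I_d).

Definition cmpartial (beta : {ffun 'I_d -> nat}) f (x : 'rV[R]_d) : R[i] :=
  mpartial beta (fun y => complex.Re (f y)) x +i*
  mpartial beta (fun y => complex.Im (f y)) x.

Definition msize (beta : {ffun 'I_d -> nat}) : nat := (\sum_i beta i)%N.

Definition mpow (x : 'rV[R]_d) (alpha : {ffun 'I_d -> nat}) : R :=
  \prod_i x ord0 i ^+ alpha i.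

Definition schwartz f : Prop :=
  csmooth f /\
  forall alpha beta : {ffun 'I_d -> nat}, exists C : R,
    forall x, `|mpow x alpha| * cmod (cmpartial beta f x) <= C.

Definition supp f : set 'rV[R]_d := closure [set x | f x != 0].

Definition Cc_infty f : Prop := csmooth f /\ compact (supp f).

Definition sqnorm2 f : \bar R :=
  (\int[lebesgue_rV d]_x (cmod (f x) ^+ 2)%:E)%E.

Definition L2 f : Prop :=
  [/\ measurable_fun [set: 'rV[R]_d] (fun x => complex.Re (f x)),
      measurable_fun [set: 'rV[R]_d] (fun x => complex.Im (f x)) &
      (sqnorm2 f < +oo)%E].

Definition inner2 f g : R[i] := cintegral (fun x => f x * conjc (g x)).

Definition is_frame (I : choiceType) (phi : I -> 'rV[R]_d -> R[i]) : Prop :=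
  exists C1 C2 : R, [/\ 0 < C1, 0 < C2 &
    forall f, L2 f ->
      (C1%:E * sqnorm2 f <=
         \esum_(i in [set: I]) (cmod (inner2 f (phi i)) ^+ 2)%:E)%E /\
      (\esum_(i in [set: I]) (cmod (inner2 f (phi i)) ^+ 2)%:E <=
         C2%:E * sqnorm2 f)%E].

End complex_functions.

Section structured_covering.
Context (R : realType) (d : nat).

(* (A, c) stands for the affine map x |-> A x + c. Vectors being rows, A x is
   x *m A^T. *)
Definition affine_map (T : 'M[R]_d * 'rV[R]_d) (x : 'rV[R]_d) : 'rV[R]_d :=
  x *m T.1^T + T.2.

Implicit Types (Ts : set ('M[R]_d * 'rV[R]_d)) (Q P : set 'rV[R]_d).

Definition aimage T Q : set 'rV[R]_d := affine_map T @` Q.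

Definition neighbours Ts Q T : set ('M[R]_d * 'rV[R]_d) :=
  [set T' | Ts T' /\ aimage T' Q `&` aimage T Q !=set0].

Definition affine_family Ts : Prop :=
  countable Ts /\ forall T, Ts T -> T.1 \in unitmx.

Definition admissible_covering Ts Q : Prop :=
  \bigcup_(T in Ts) aimage T Q = setT /\
  exists n0 : nat, forall T, Ts T -> (neighbours Ts Q T #<= `I_n0)%card.

Definition moderate (I : Type) (D : set I) (S : I -> set 'rV[R]_d) : Prop :=
  exists C : R, 0 < C /\
    forall i, D i -> forall x y, S i x -> S i y -> weight x <= C * weight y.

Definition structured_covering Ts Q : Prop :=
  [/\ affine_family Ts, bounded_set Q, open Q &
  exists P,
  [/\ bounded_set P, open P, P `<=` Q, compactly_contained P Q &
  [/\ admissible_covering Ts P /\ admissible_covering Ts Q,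
      exists K : R, 0 < K /\
        forall T T', Ts T -> Ts T' -> aimage T' Q `&` aimage T Q !=set0 ->
          mx_norm (invmx T'.1 *m T.1) <= K,
      exists Ks : R, 0 < Ks /\
        forall T, Ts T -> mx_norm (invmx T.1) <= Ks &
      exists xi : 'M[R]_d * 'rV[R]_d -> 'rV[R]_d,
      [/\ exists delta, delta_separated Ts delta xi,
          forall T, Ts T -> aimage T Q (xi T),
          moderate Ts (aimage^~ Q) &
          exists gamma : R, 0 < gamma /\
            forall T, Ts T ->
              (lebesgue_rV d (aimage T Q) <= (weight (xi T) `^ gamma)%:E)%E]]]].

End structured_covering.

Section nsgf.
Context (R : realType) (d : nat).
Variables (h : 'rV[int]_d -> 'rV[R]_d -> R[i]) (a : 'rV[int]_d -> R)
  (b : 'rV[int]_d -> 'rV[R]_d) (Cstar : R).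
Implicit Types m n : 'rV[int]_d.

Definition nsgf_atom (mn : 'rV[int]_d * 'rV[int]_d) (x : 'rV[R]_d) : R[i] :=
  h mn.1 (x - a mn.1 *: map_mx intr mn.2).

Definition nsgf_eps m : R := Cstar / a m.

Definition nsgf_cube m : set 'rV[R]_d :=
  [set xi : 'rV[R]_d | forall j,
    - nsgf_eps m + b m ord0 j < xi ord0 j < (a m)^-1 + nsgf_eps m + b m ord0 j].

Definition nsgf_neighbours m : set 'rV[int]_d :=
  [set m' | nsgf_cube m' `&` nsgf_cube m !=set0].

Record painless_nsgf : Prop := PainlessNsgf {
  nsgf_schwartz : forall m, schwartz (h m);
  nsgf_step_gt0 : forall m, 0 < a m;
  nsgf_supp : forall m, supp (fourier (h m)) `<=`
    [set xi : 'rV[R]_d | forall j, b m ord0 j <= xi ord0 j <= (a m)^-1 + b m ord0 j];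
  nsgf_frame : is_frame nsgf_atom;
  nsgf_Cstar_gt0 : 0 < Cstar;
  nsgf_smooth : forall m, Cc_infty (fourier (h m));
  nsgf_decay : forall beta : {ffun 'I_d -> nat}, exists C : R, 0 < C /\
    forall m xi, cmod (cmpartial beta (fourier (h m)) xi) <=
      C * a m `^ (d%:R / 2 + (msize beta)%:R);
  nsgf_step_bounded : (ereal_sup [set (a m)%:E | m in [set: 'rV[int]_d]] < +oo)%E;
  nsgf_overlap : exists n0 : nat, forall m, (nsgf_neighbours m #<= `I_n0)%card;
  nsgf_step_equiv : exists C1 C2 : R, [/\ 0 < C1, 0 < C2 &
    forall m m', nsgf_neighbours m m' -> C1 * a m <= a m' <= C2 * a m];
  nsgf_separated : exists delta, delta_separated setT delta b;
  nsgf_moderate : moderate setT nsgf_cube;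
  nsgf_volume : exists gamma : R, 0 < gamma /\
    forall m, (lebesgue_rV d (nsgf_cube m) <= (weight (b m) `^ gamma)%:E)%E }.

End nsgf.

(* Main.v *)
(** The only clause that needs analysis is that the cubes shrunk to
    [P = (e, 1 - e)^d] still cover [R^d]; since [T_m(P)] is the support cube of
    the m-th generator enlarged by [eps_m / 2], this comes from the lower frame
    bound. The steps are bounded, so the [eps_m] are bounded below, and a point
    outside every [T_m(P)] is the centre of a box missing the support of every
    [fourier (h m)]. The product [f] of modulated sinc functions, whose Fourier
    transform is the indicator of that box, is a nonzero element of L2, and
    writing [f] as the integral of characters over the box and exchanging the
    integrals shows that [f] is orthogonal to every atom. *)

Require Import Defs.
From mathcomp Require Import all_boot all_order all_algebra.
From mathcomp Require Import complex.
From mathcomp Require Import all_classical all_reals all_analysis.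
From mathcomp Require Import measurable_realfun ring lra.

Import Order.TTheory GRing.Theory Num.Theory.
Import numFieldNormedType.Exports.

Local Open Scope classical_set_scope.
Local Open Scope ring_scope.
Local Open Scope complex_scope.

Set Implicit Arguments.
Unset Strict Implicit.
Unset Printing Implicit Defensive.

(** * Fubini's theorem for functions dominated by a product *)

Section product_integrals.
Context d1 d2 (T1 : measurableType d1) (T2 : measurableType d2) (R : realType).
Variables (m1 : {sigma_finite_measure set T1 -> \bar R}).
Variables (m2 : {sigma_finite_measure set T2 -> \bar R}).
Variables (p : T1 -> R) (q : T2 -> R).
Hypotheses (ip : m1.-integrable setT (EFin \o p))
           (iq : m2.-integrable setT (EFin \o q)).

Let mp : measurable_fun setT p.
Proof. exact/measurable_EFinP/(measurable_int m1). Qed.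

Let mq : measurable_fun setT q.
Proof. exact/measurable_EFinP/(measurable_int m2). Qed.

(** By Tonelli it suffices to bound the iterated integral of [|F|]: the inner integral at [x] is at
    most [|p x|] times the L1 norm of [q], and this bound is integrable in [x]. *)
Lemma integrable_prod_dominated (F : T1 * T2 -> R) :
  measurable_fun setT F -> (forall x y, `|F (x, y)| <= `|p x| * `|q y|) ->
  (m1 \x m2)%E.-integrable setT (EFin \o F).
Proof.
move=> mF FE; apply/integrable12ltyP; first exact/measurable_EFinP.
have qoo : (\int[m2]_y `|(q y)%:E| < +oo)%E by have /integrableP[] := iq.
have poo : (\int[m1]_x `|(p x)%:E| < +oo)%E by have /integrableP[] := ip.
have bnd x : (\int[m2]_y `|(EFin \o F) (x, y)| <=
    `|(p x)%:E| * \int[m2]_y `|(q y)%:E|)%E.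
  rewrite -ge0_integralZl//; last by do 2 apply: measurableT_comp => //.
  apply: ge0_le_integral => //.
  - apply: measurableT_comp => //; apply: measurableT_comp => //.
    by apply: measurableT_comp => //; exact: pair1_measurable.
  - apply: measurable_funeM; do 2 apply: measurableT_comp => //.
  - by move=> y _ /=; rewrite lee_fin; exact: FE.
apply: (@le_lt_trans _ _
  (\int[m1]_x (`|(p x)%:E| * \int[m2]_y `|(q y)%:E|))%E); last first.
  rewrite ge0_integralZr//; last 2 first.
    by do 2 apply: measurableT_comp => //.
    by apply: integral_ge0.
  by apply: lte_mul_pinfty => //; [exact: integral_ge0|
    rewrite ge0_fin_numE//; exact: integral_ge0].
apply: ge0_le_integral => //.
- by move=> x _; exact: integral_ge0.
- apply: (measurable_fun_fubini_tonelli_F (abse \o (EFin \o F))) => //=.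
  by apply: measurableT_comp => //; exact: measurableT_comp.
- by apply: emeasurable_funM => //; do 2 apply: measurableT_comp => //.
Qed.

Lemma integrable_section1 (F : T1 * T2 -> R) x :
  measurable_fun setT F -> (forall x y, `|F (x, y)| <= `|p x| * `|q y|) ->
  m2.-integrable setT (fun y => (F (x, y))%:E).
Proof.
move=> mF FE; have iqx : m2.-integrable setT (fun y => (`|p x| * `|q y|)%:E).
  under eq_fun do rewrite EFinM; apply: integrableZl => //.
  exact: integrable_abse iq.
apply: le_integrable iqx => //.
  by apply/measurable_EFinP; apply: measurableT_comp => //; exact: pair1_measurable.
by move=> y _; rewrite lee_fin [leRHS]ger0_norm ?mulr_ge0//; exact: FE.
Qed.

Lemma integrable_section2 (F : T1 * T2 -> R) y :
  measurable_fun setT F -> (forall x y, `|F (x, y)| <= `|p x| * `|q y|) ->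
  m1.-integrable setT (fun x => (F (x, y))%:E).
Proof.
move=> mF FE; have ipy : m1.-integrable setT (fun x => (`|p x| * `|q y|)%:E).
  under eq_fun do rewrite EFinM; apply: integrableZr => //.
  exact: integrable_abse ip.
apply: le_integrable ipy => //.
  by apply/measurable_EFinP; apply: measurableT_comp => //; exact: pair2_measurable.
by move=> x _; rewrite lee_fin [leRHS]ger0_norm ?mulr_ge0//; exact: FE.
Qed.

Lemma Rintegral_prod_dominated (F : T1 * T2 -> R) :
  measurable_fun setT F -> (forall x y, `|F (x, y)| <= `|p x| * `|q y|) ->
  (\int[(m1 \x m2)%E]_z F z = \int[m1]_x \int[m2]_y F (x, y))%R.
Proof.
move=> mF FE; have iF := integrable_prod_dominated mF FE.
rewrite /Rintegral -integral12_prod_meas1//; congr fine.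
(* The real-valued inner integral applies [fine]. Nothing is lost, since the domination makes every
   section integrable, not merely almost every one. *)
apply: eq_integral => x _; rewrite /fubini_F fineK//.
by apply: integrable_fin_num => //; exact: integrable_section1.
Qed.

Lemma Rintegral_swap_dominated (F : T1 * T2 -> R) :
  measurable_fun setT F -> (forall x y, `|F (x, y)| <= `|p x| * `|q y|) ->
  (\int[m1]_x \int[m2]_y F (x, y) = \int[m2]_y \int[m1]_x F (x, y))%R.
Proof.
move=> mF FE; have iF := integrable_prod_dominated mF FE.
rewrite -Rintegral_prod_dominated// /Rintegral -integral21_prod_meas1//.
congr fine; apply: eq_integral => y _; rewrite /fubini_G fineK//.
by apply: integrable_fin_num => //; exact: integrable_section2.
Qed.

Lemma measurable_fun_prodM :
  measurable_fun setT (fun z : T1 * T2 => p z.1 * q z.2).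
Proof. by apply: measurable_funM; apply: measurableT_comp. Qed.

Lemma integrable_prodM :
  (m1 \x m2)%E.-integrable setT (fun z => (p z.1 * q z.2)%:E).
Proof.
apply: (@integrable_prod_dominated (fun z => p z.1 * q z.2)).
  exact: measurable_fun_prodM.
by move=> x y; rewrite normrM.
Qed.

Lemma Rintegral_prodM : (\int[(m1 \x m2)%E]_z (p z.1 * q z.2) =
  (\int[m1]_x p x) * \int[m2]_y q y)%R.
Proof.
rewrite (@Rintegral_prod_dominated (fun z => p z.1 * q z.2)).
- rewrite -RintegralZr//; apply: eq_Rintegral => x _ /=.
  by rewrite RintegralZl.
- exact: measurable_fun_prodM.
- by move=> x y; rewrite normrM.
Qed.

End product_integrals.

(** * Complex-valued integration through real and imaginary parts *)

Section complex_numbers.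
Variable R : realType.

Lemma ReM (z w : R[i]) : complex.Re (z * w) =
  complex.Re z * complex.Re w - complex.Im z * complex.Im w.
Proof. by case: z => a b; case: w. Qed.

Lemma ImM (z w : R[i]) : complex.Im (z * w) =
  complex.Re z * complex.Im w + complex.Im z * complex.Re w.
Proof. by case: z => a b; case: w. Qed.

Lemma sqr_cmod (z : R[i]) :
  cmod z ^+ 2 = complex.Re z ^+ 2 + complex.Im z ^+ 2.
Proof. by case: z => a b; rewrite /cmod /= sqr_sqrtr// addr_ge0 ?sqr_ge0. Qed.

Lemma cmod_ge0 (z : R[i]) : 0 <= cmod z.
Proof. by case: z => a b; exact: sqrtr_ge0. Qed.

Lemma normRe_cmod (z : R[i]) : `|complex.Re z| <= cmod z.
Proof.
case: z => a b; rewrite /cmod /= -sqrtr_sqr ler_sqrt ?lerDl ?sqr_ge0//.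
by rewrite addr_ge0 ?sqr_ge0.
Qed.

Lemma normIm_cmod (z : R[i]) : `|complex.Im z| <= cmod z.
Proof.
case: z => a b; rewrite /cmod /= -sqrtr_sqr ler_sqrt ?lerDr ?sqr_ge0//.
by rewrite addr_ge0 ?sqr_ge0.
Qed.

Lemma le_cmod_ReIm (z : R[i]) : cmod z <= `|complex.Re z| + `|complex.Im z|.
Proof.
rewrite -(@ler_pXn2r _ 2)// ?nnegrE ?cmod_ge0 ?addr_ge0//.
rewrite sqr_cmod sqrrD !real_normK ?num_real// lerD2r lerDl.
by rewrite mulrn_wge0 ?mulr_ge0.
Qed.

Lemma cmodM (z w : R[i]) : cmod (z * w) = cmod z * cmod w.
Proof. exact: ComplexField.Normc.normcM. Qed.

Lemma cmod_conj (z : R[i]) : cmod (conjc z) = cmod z.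
Proof. by case: z => a b; rewrite /cmod /= sqrrN. Qed.

Lemma cmod_real (x : R) : cmod x%:C = `|x|.
Proof. by rewrite /cmod /= expr0n addr0 sqrtr_sqr. Qed.

Lemma cmod_prod (I : Type) (s : seq I) (f : I -> R[i]) :
  cmod (\prod_(i <- s) f i) = \prod_(i <- s) cmod (f i).
Proof. by apply: big_morph; [exact: cmodM|rewrite /cmod ComplexField.Normc.normc1]. Qed.

End complex_numbers.

Section complex_integral.
Context d (T : measurableType d) (R : realType).
Implicit Types (mu : {measure set T -> \bar R}) (f : T -> R[i]).

(** Extends [cintegral] to an arbitrary measure. For [lebesgue_rV d] the two are convertible, so
    [fourier] and [inner2] can be restated with it directly. *)
Definition Cintegral mu f : R[i] :=
  (\int[mu]_x complex.Re (f x))%R +i* (\int[mu]_x complex.Im (f x))%R.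

Definition Cintegrable mu f : Prop :=
  mu.-integrable setT (fun x => (complex.Re (f x))%:E) /\
  mu.-integrable setT (fun x => (complex.Im (f x))%:E).

Definition Cmeasurable f : Prop :=
  measurable_fun setT (fun x => complex.Re (f x)) /\
  measurable_fun setT (fun x => complex.Im (f x)).

Lemma CintegralZl mu c f : Cintegrable mu f ->
  Cintegral mu (fun x => c * f x) = c * Cintegral mu f.
Proof.
move=> [iR iI]; rewrite /Cintegral; apply/eqP; rewrite eq_complex ReM ImM /=.
have iZ k g : mu.-integrable setT (EFin \o g) ->
    mu.-integrable setT (EFin \o (fun x => k * g x)).
  move=> ig; rewrite (_ : _ \o _ = fun x => k%:E * (g x)%:E)%E//.
  exact: integrableZl.
apply/andP; split; apply/eqP.
  under eq_Rintegral do rewrite ReM.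
  by rewrite RintegralB ?RintegralZl//; exact: iZ.
under eq_Rintegral do rewrite ImM.
by rewrite RintegralD ?RintegralZl//; exact: iZ.
Qed.

Lemma Cintegral_conj mu f : Cintegrable mu f ->
  Cintegral mu (fun x => conjc (f x)) = conjc (Cintegral mu f).
Proof.
move=> [iR iI]; apply/eqP; rewrite eq_complex /=; apply/andP; split; apply/eqP.
  by apply: eq_Rintegral => x _; case: (f x).
transitivity (\int[mu]_x ((-1) * complex.Im (f x)))%R.
  by apply: eq_Rintegral => x _; case: (f x) => u v /=; rewrite mulN1r.
by rewrite RintegralZl// mulN1r.
Qed.

Lemma Cmeasurable_mul f g : Cmeasurable f -> Cmeasurable g ->
  Cmeasurable (fun x => f x * g x).
Proof.
move=> [fR fI] [gR gI]; split.
- by under eq_fun do rewrite ReM; apply: measurable_funB; apply: measurable_funM.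
- by under eq_fun do rewrite ImM; apply: measurable_funD; apply: measurable_funM.
Qed.

Lemma Cmeasurable_prod (I : Type) (s : seq I) (f : I -> T -> R[i]) :
  (forall i, Cmeasurable (f i)) -> Cmeasurable (fun x => \prod_(i <- s) f i x).
Proof.
move=> mf; elim: s => [|i s IH].
  by split; under eq_fun do rewrite big_nil; exact: measurable_cst.
under [in X in Cmeasurable X]eq_fun do rewrite big_cons.
exact: Cmeasurable_mul.
Qed.

Lemma Cmeasurable_conj f : Cmeasurable f -> Cmeasurable (fun x => conjc (f x)).
Proof.
move=> [fR fI]; split.
- by rewrite (_ : (fun _ => _) = fun x => complex.Re (f x))//;
    apply/funext => x; case: (f x).
- rewrite (_ : (fun _ => _) = fun x => - complex.Im (f x)).
    exact: measurableT_comp.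
  by apply/funext => x; case: (f x).
Qed.

Lemma Cintegrable_Cmeasurable mu f : Cintegrable mu f -> Cmeasurable f.
Proof. by move=> [? ?]; split; apply/measurable_EFinP/(measurable_int mu). Qed.

Lemma Cintegrable_dominated mu f (g : T -> R) : Cmeasurable f ->
  mu.-integrable setT (EFin \o g) -> (forall x, cmod (f x) <= g x) ->
  Cintegrable mu f.
Proof.
move=> [fR fI] ig fg; split; (apply: le_integrable ig => //;
  [exact/measurable_EFinP|move=> x _; rewrite lee_fin;
   apply: le_trans (ler_norm _); apply: le_trans (fg x)]).
- exact: normRe_cmod.
- exact: normIm_cmod.
Qed.

Lemma Cintegrable_cmod mu f : Cintegrable mu f ->
  mu.-integrable setT
    (EFin \o (fun x => `|complex.Re (f x)| + `|complex.Im (f x)|)).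
Proof.
move=> [iR iI].
rewrite (_ : _ \o _ = (fun x => `|(complex.Re (f x))%:E| + `|(complex.Im (f x))%:E|)%E)//.
by apply: integrableD => //; exact: integrable_abse.
Qed.

End complex_integral.

Lemma Cintegral_swap d1 d2 (T1 : measurableType d1) (T2 : measurableType d2)
    (R : realType) (m1 : {sigma_finite_measure set T1 -> \bar R})
    (m2 : {sigma_finite_measure set T2 -> \bar R})
    (p : T1 -> R) (q : T2 -> R) (F : T1 * T2 -> R[i]) :
  m1.-integrable setT (EFin \o p) -> m2.-integrable setT (EFin \o q) ->
  Cmeasurable F -> (forall x y, cmod (F (x, y)) <= `|p x| * `|q y|) ->
  Cintegral m1 (fun x => Cintegral m2 (fun y => F (x, y))) =
  Cintegral m2 (fun y => Cintegral m1 (fun x => F (x, y))).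
Proof.
move=> ip iq [mR mI] Fpq; rewrite /Cintegral /=; congr (_ +i* _).
- apply: (Rintegral_swap_dominated ip iq mR) => x y.
  exact: le_trans (normRe_cmod _) (Fpq _ _).
- apply: (Rintegral_swap_dominated ip iq mI) => x y.
  exact: le_trans (normIm_cmod _) (Fpq _ _).
Qed.

Section complex_product.
Context d1 d2 (T1 : measurableType d1) (T2 : measurableType d2) (R : realType).
Variables (m1 : {sigma_finite_measure set T1 -> \bar R}).
Variables (m2 : {sigma_finite_measure set T2 -> \bar R}).
Variables (u : T1 -> R[i]) (v : T2 -> R[i]).
Hypotheses (iu : Cintegrable m1 u) (iv : Cintegrable m2 v).

Lemma Cintegrable_prodM :
  Cintegrable (m1 \x m2)%E (fun z : T1 * T2 => u z.1 * v z.2).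
Proof.
case: iu iv => uR uI [vR vI]; split.
- rewrite (_ : (fun _ => _) = (fun z : T1 * T2 =>
    (complex.Re (u z.1) * complex.Re (v z.2))%:E -
    (complex.Im (u z.1) * complex.Im (v z.2))%:E)%E).
    apply: integrableB => //; [exact: (integrable_prodM uR vR)|].
    exact: (integrable_prodM uI vI).
  by apply/funext => z; rewrite ReM.
- rewrite (_ : (fun _ => _) = (fun z : T1 * T2 =>
    (complex.Re (u z.1) * complex.Im (v z.2))%:E +
    (complex.Im (u z.1) * complex.Re (v z.2))%:E)%E).
    apply: integrableD => //; [exact: (integrable_prodM uR vI)|].
    exact: (integrable_prodM uI vR).
  by apply/funext => z; rewrite ImM.
Qed.

Lemma Cintegral_prodM :
  Cintegral (m1 \x m2)%E (fun z : T1 * T2 => u z.1 * v z.2) =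
  Cintegral m1 u * Cintegral m2 v.
Proof.
case: iu iv => uR uI [vR vI].
apply/eqP; rewrite eq_complex ReM ImM; apply/andP; split; apply/eqP.
- rewrite [LHS]/complex.Re /Cintegral; under eq_Rintegral do rewrite ReM.
  rewrite RintegralB//; [|exact: (integrable_prodM uR vR)|
    exact: (integrable_prodM uI vI)].
  by congr (_ - _); [exact: (Rintegral_prodM uR vR)|
    exact: (Rintegral_prodM uI vI)].
- rewrite [LHS]/complex.Im /Cintegral; under eq_Rintegral do rewrite ImM.
  rewrite RintegralD//; [|exact: (integrable_prodM uR vI)|
    exact: (integrable_prodM uI vR)].
  by congr (_ + _); [exact: (Rintegral_prodM uR vI)|
    exact: (Rintegral_prodM uI vR)].
Qed.

End complex_product.

Section transfer_complex.
Context d1 d2 (X : measurableType d1) (Y : measurableType d2) (R : realType).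
Variables (mu : {measure set X -> \bar R}) (nu : {measure set Y -> \bar R}).
Variables (phi : X -> Y) (f : Y -> R[i]).
Hypotheses (mphi : measurable_fun setT phi)
  (nuE : forall A, measurable A -> nu A = mu (phi @^-1` A)).
Hypotheses (mf : Cmeasurable f) (i_f : Cintegrable mu (f \o phi)).

(** Change of variables, for a [nu] that agrees with the image of [mu] on measurable sets. It serves
    both for [rV_cons], which builds [lebesgue_rV] one coordinate at a time, and for
    translations. *)
Let transfer (g : Y -> R) : measurable_fun setT g ->
  mu.-integrable setT (fun x => (g (phi x))%:E) ->
  nu.-integrable setT (EFin \o g) /\
  (\int[nu]_y (g y)%:E = \int[mu]_x (g (phi x))%:E)%E.
Proof.
move=> mg ig; have mG : measurable_fun setT (EFin \o g) by exact/measurable_EFinP.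
split; last first.
  rewrite -(@integral_pushforward _ _ _ _ _ phi mphi mu setT (EFin \o g))//.
  by apply: eq_measure_integral => A mA _; exact: nuE.
have := @integrable_pushforward _ _ _ _ _ phi mphi mu setT (EFin \o g) mG ig
  measurableT.
move=> /integrableP[_ goo]; apply/integrableP; split => //.
rewrite (le_lt_trans _ goo)// le_eqVlt; apply/orP; left; apply/eqP.
by apply: eq_measure_integral => A mA _; exact: nuE.
Qed.

Lemma Cintegrable_transfer : Cintegrable nu f.
Proof.
case: mf i_f => mR mI [iR iI].
by split; [exact: (transfer mR iR).1|exact: (transfer mI iI).1].
Qed.

Lemma Cintegral_transfer : Cintegral nu f = Cintegral mu (f \o phi).
Proof.
case: mf i_f => mR mI [iR iI]; rewrite /Cintegral /Rintegral.
by rewrite (transfer mR iR).2 (transfer mI iI).2.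
Qed.

End transfer_complex.

(** * Lebesgue measure on row vectors: product functions, translations, open sets *)

Section rV_product.
Variable R : realType.

Lemma Cmeasurable_rV_prod n (u : 'I_n -> measurableTypeR R -> R[i]) :
  (forall i, Cmeasurable (u i)) ->
  Cmeasurable (fun x : 'rV[R]_n => \prod_i u i (x ord0 i)).
Proof.
move=> mu; apply: Cmeasurable_prod => i; have [mR mI] := mu i.
by split; [apply: measurableT_comp mR (measurable_coord i)|
           apply: measurableT_comp mI (measurable_coord i)].
Qed.

(** Induction on the dimension: [rV_cons] splits off the first factor, and the integral of a product
    of functions of separate variables factorises. *)
Lemma Cintegral_rV_prod n (u : 'I_n -> measurableTypeR R -> R[i]) :
  (forall i, Cintegrable lebesgue_measure (u i)) ->
  Cintegrable (lebesgue_rV n) (fun x : 'rV[R]_n => \prod_i u i (x ord0 i)) /\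
  Cintegral (lebesgue_rV n) (fun x : 'rV[R]_n => \prod_i u i (x ord0 i)) =
    \prod_i Cintegral lebesgue_measure (u i).
Proof.
elim: n u => [|n IH] u iu.
  (* In dimension zero the measure is a Dirac mass of total mass 1, so the empty product integrates
     to 1. *)
  rewrite big_ord0; under eq_fun do rewrite big_ord0.
  split; first by split => /=; apply: finite_measure_integrable_cst.
  have E1 : lebesgue_rV 0 [set: 'rV[R]_0] = 1%E by rewrite /= diracE mem_set.
  rewrite /Cintegral.
  rewrite (Rintegral_cst (lebesgue_rV 0) measurableT 1).
  rewrite (Rintegral_cst (lebesgue_rV 0) measurableT 0).
  rewrite mul0r mul1r (_ : fine _ = 1)//.
  exact: (congr1 fine E1).
have [iV EV] := IH (fun i => u (lift ord0 i)) (fun i => iu _).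
have mF : Cmeasurable (fun x : 'rV[R]_n.+1 => \prod_i u i (x ord0 i)).
  by apply: Cmeasurable_rV_prod => i; exact: Cintegrable_Cmeasurable (iu i).
have E : (fun x : 'rV[R]_n.+1 => \prod_i u i (x ord0 i)) \o @rV_cons R n =
    fun z => u ord0 z.1 * \prod_i u (lift ord0 i) (z.2 ord0 i).
  apply/funext => -[t x] /=; rewrite big_ord_recl mxE unlift_none /=.
  by congr (_ * _); apply: eq_bigr => i _; rewrite mxE liftK.
have iF : Cintegrable (lebesgue_measure \x lebesgue_rV n)%E
    ((fun x : 'rV[R]_n.+1 => \prod_i u i (x ord0 i)) \o @rV_cons R n).
  by rewrite E; exact: (Cintegrable_prodM (iu ord0) iV).
have mc := @measurable_rV_cons R n.
have nuE A : measurable A -> lebesgue_rV n.+1 A =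
  (lebesgue_measure \x lebesgue_rV n)%E (@rV_cons R n @^-1` A) by [].
split; first exact: (Cintegrable_transfer mc nuE mF iF).
rewrite (Cintegral_transfer mc nuE mF iF) E (Cintegral_prodM (iu ord0) iV).
by rewrite EV big_ord_recl.
Qed.

(** The image of Lebesgue measure under a translation gives half-open intervals their length, and
    these values determine the measure. *)
Lemma lebesgue_measure_shift (c : R) (A : set R) : measurable A ->
  @lebesgue_measure R ((fun x : measurableTypeR R => x + c) @^-1` A) =
  lebesgue_measure A.
Proof.
have mf : measurable_fun setT
    ((fun x => x + c) : measurableTypeR R -> measurableTypeR R).
  exact: measurable_funD.
move=> mA.
rewrite -[LHS]/(pushforward lebesgue_measure
  ((fun x => x + c) : measurableTypeR R -> measurableTypeR R) A).
apply/esym/lebesgue_measure_unique => //= _ [[a b]] _ <-.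
rewrite /pushforward (_ : _ @^-1` _ = `]a - c, b - c]%classic).
  rewrite !lebesgue_measure_itv/= !lte_fin ltrD2r.
  by case: ifP => // _; rewrite -!EFinB; congr EFin; ring.
by apply/seteqP; split => x /=; rewrite !in_itv/= ltrBlDr lerBrDr.
Qed.

Lemma measurable_rV_shift n (c : 'rV[R]_n) :
  measurable_fun setT (fun x : 'rV[R]_n => x + c).
Proof.
apply: measurable_fun_rV => i; under eq_fun do rewrite mxE.
by apply: measurable_funD => //; exact: measurable_coord.
Qed.

(** A translation acts separately on the first coordinate and on the others. By induction both
    actions preserve measure, and a product measure is determined by its values on rectangles. *)
Lemma lebesgue_rV_shift n (c : 'rV[R]_n) (A : set 'rV[R]_n) : measurable A ->
  lebesgue_rV n ((fun x => x + c) @^-1` A) = lebesgue_rV n A.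
Proof.
elim: n c A => [|n IH] c A mA.
  congr (lebesgue_rV 0 _); apply/seteqP; split => x /=;
  by rewrite (_ : x + c = x)//; apply/rowP => -[].
pose c' : 'rV[R]_n := \row_j c ord0 (lift ord0 j).
pose sh (z : measurableTypeR R * 'rV[R]_n) : measurableTypeR R * 'rV[R]_n :=
  (z.1 + c ord0 ord0, z.2 + c').
have msh : measurable_fun setT sh.
  apply/measurable_fun_pairP; split.
    by apply: measurable_funD => //; exact: measurable_fst.
  apply: (measurableT_comp (measurable_rV_shift c')); exact: measurable_snd.
have mB : measurable (@rV_cons R n @^-1` A).
  by rewrite -[X in measurable X]setTI; exact: measurable_rV_cons.
have E0 z : rV_cons z + c = rV_cons (sh z).
  case: z => t x; apply/rowP => i; rewrite !mxE.
  by case: (unliftP ord0 i) => [j ->|->]; rewrite ?mxE.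
have SE : @rV_cons R n @^-1` ((fun x => x + c) @^-1` A) =
    sh @^-1` (@rV_cons R n @^-1` A).
  by apply/seteqP; split => z; rewrite /preimage /mkset E0.
transitivity (pushforward (lebesgue_measure \x lebesgue_rV n)%E sh
    (@rV_cons R n @^-1` A)).
  by rewrite /pushforward -SE.
transitivity ((lebesgue_measure \x lebesgue_rV n)%E (@rV_cons R n @^-1` A)) => //.
apply/esym/product_measure_unique => // X Y mX mY /=; rewrite /pushforward.
rewrite -(lebesgue_measure_shift (c ord0 ord0) mX) -(IH c' Y mY).
rewrite -product_measure1E//.
- by rewrite -[X in measurable X]setTI; exact: measurable_funD.
- by rewrite -[X in measurable X]setTI; exact: measurable_rV_shift.
Qed.

Lemma Cintegrable_shift n (c : 'rV[R]_n) (f : 'rV[R]_n -> R[i]) :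
  Cintegrable (lebesgue_rV n) f ->
  Cintegrable (lebesgue_rV n) (fun x => f (x + c)).
Proof.
move=> i_f; set g := fun x => _.
have mg : Cmeasurable g.
  have [mR mI] := Cintegrable_Cmeasurable i_f.
  by split; [apply: measurableT_comp mR (measurable_rV_shift c)|
             apply: measurableT_comp mI (measurable_rV_shift c)].
(* The transfer goes along the opposite translation, which turns [g] back into [f]. *)
have ms := measurable_rV_shift (- c).
apply: (Cintegrable_transfer (mu := lebesgue_rV n) ms) => //.
  by move=> A mA; exact/esym/lebesgue_rV_shift.
by rewrite (_ : _ \o _ = f)//; apply/funext => x /=; rewrite /g subrK.
Qed.

Lemma Cintegral_shift n (c : 'rV[R]_n) (f : 'rV[R]_n -> R[i]) :
  Cintegrable (lebesgue_rV n) f ->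
  Cintegral (lebesgue_rV n) (fun x => f (x + c)) = Cintegral (lebesgue_rV n) f.
Proof.
move=> i_f; have ms := measurable_rV_shift c.
apply/esym; apply: (Cintegral_transfer ms) => //.
- by move=> A mA; exact/esym/lebesgue_rV_shift.
- exact: Cintegrable_Cmeasurable i_f.
- exact: Cintegrable_shift.
Qed.

(** Links the topology to the sigma-algebra generated by the coordinates: an open set is the
    countable union of the cubes with rational centre and half-side [1/(k+1)] that it contains. *)
Lemma open_measurable_rV n (U : set 'rV[R]_n) : open U -> measurable U.
Proof.
move=> oU.
pose B (q : 'rV[rat]_n) (k : nat) : set 'rV[R]_n :=
  [set x | forall i, `|x ord0 i - ratr (q ord0 i)| < k.+1%:R^-1].
have mB q k : measurable (B q k).
  rewrite (_ : B q k = \big[setI/setT]_(i < n)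
    ((fun x : 'rV[R]_n => x ord0 i : measurableTypeR R) @^-1`
      (ball (ratr (q ord0 i) : R) k.+1%:R^-1))).
    apply: bigsetI_measurable => i _; rewrite -[X in measurable X]setTI.
    by apply: measurable_coord => //; exact: measurable_ball.
  rewrite -bigcap_seq; apply/seteqP; split => x /= H i //.
    by move=> _; rewrite /ball/= distrC; exact: H.
  by have := H i; rewrite /ball/= distrC; apply; rewrite /= mem_index_enum.
pose D : set ('rV[rat]_n * nat) := [set qk | B qk.1 qk.2 `<=` U].
rewrite (_ : U = \bigcup_(qk in D) B qk.1 qk.2); last first.
  apply/seteqP; split=> [x Ux|x [qk Dqk]]; last exact: Dqk.
  have /nbhs_ballP[e /= e0 xeU] := open_nbhs_nbhs (conj oU Ux).
  (* Two points of a cube of half-side below [e / 2] are less than [e] apart, so a cube containing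
     [x] stays in the ball around [x]. *)
  have [k ke] : exists k, k.+1%:R^-1 < e / 2 :> R.
    exists (Num.truncn (e / 2)^-1); rewrite invf_plt ?posrE ?divr_gt0//.
    exact: truncnS_gt.
  have k0 : 0 < k.+1%:R^-1 :> R by [].
  have qP i : exists q : rat, `|x ord0 i - ratr q| < k.+1%:R^-1.
    have /rat_in_itvoo[q] : x ord0 i - k.+1%:R^-1 < x ord0 i + k.+1%:R^-1.
      by rewrite ltrD2l gtrN.
    rewrite in_itv/= => /andP[q1 q2]; exists q.
    by rewrite ltr_norml; move: q1 q2; move: (k.+1%:R^-1 : R) => e'; lra.
  have [q qx] := choice qP.
  exists (\row_i q i, k) => [|i] /=; last by rewrite mxE.
  move=> y /= yB; apply: xeU; split => // i j; rewrite (ord1 i) /ball/=.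
  have := yB j; have := qx j; rewrite !ltr_norml mxE.
  by move: ke; move: (k.+1%:R^-1 : R) => e'; lra.
rewrite bigcup_mkcond; apply: countable_bigcupT_measurable => // qk.
by case: ifP.
Qed.

End rV_product.

(** * Characters, and the Fourier transform of an interval *)

Section cexpi.
Variable R : realType.

Lemma cexpiD (s t : R) : cexpi (s + t) = cexpi s * cexpi t.
Proof.
rewrite /cexpi cosD sinD; apply/eqP; rewrite eq_complex /= eqxx /=.
by rewrite addrC.
Qed.

Lemma cexpi0 : cexpi (0 : R) = 1.
Proof. by rewrite /cexpi cos0 sin0. Qed.

Lemma cexpiN (t : R) : cexpi (- t) = conjc (cexpi t).
Proof. by rewrite /cexpi cosN sinN. Qed.

Lemma cexpi_sum (I : finType) (s : I -> R) :
  cexpi (\sum_i s i) = \prod_i cexpi (s i).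
Proof. exact: (big_morph _ cexpiD cexpi0). Qed.

Lemma cmod_cexpi (t : R) : cmod (cexpi t) = 1.
Proof. by rewrite /cmod /= cos2Dsin2 sqrtr1. Qed.

Lemma Cmeasurable_cexpi d (T : measurableType d) (f : T -> R) :
  measurable_fun setT f -> Cmeasurable (fun x => cexpi (f x)).
Proof.
move=> mf; split => /=; apply: measurableT_comp => //;
  apply: continuous_measurable_fun; [exact: continuous_cos|exact: continuous_sin].
Qed.

End cexpi.

Section interval_transform.
Variable R : realType.
Local Notation mu := (@lebesgue_measure R).

Lemma Rintegral_cos (k a b : R) : k != 0 -> a < b ->
  (\int[mu]_(t in `[a, b]) cos (k * t) = (sin (k * b) - sin (k * a)) / k)%R.
Proof.
move=> k0 ab; pose F t : R := sin (k * t) / k.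
have dF t : is_derive t (1 : R) F (cos (k * t)).
  rewrite /F; apply: is_derive_eq.
  by rewrite /GRing.scale /=; field.
rewrite /Rintegral (@continuous_FTC2 _ _ F)//.
- by rewrite -EFinB /= /F mulrBl.
- apply: continuous_subspaceT => t.
  by apply: continuous_comp; [exact: mulrl_continuous|exact: continuous_cos].
- have cF : continuous F.
    by move=> t; apply/differentiable_continuous/derivable1_diffP; exact: ex_derive.
  by split; [move=> t _; exact: ex_derive|apply: cvg_at_right_filter|
    apply: cvg_at_left_filter]; exact: cF.
- by move=> t _; rewrite derive1E; exact: derive_val.
Qed.

Lemma Rintegral_sin (k a b : R) : k != 0 -> a < b ->
  (\int[mu]_(t in `[a, b]) sin (k * t) = (cos (k * a) - cos (k * b)) / k)%R.
Proof.
move=> k0 ab; pose F t : R := - (cos (k * t) / k).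
have dF t : is_derive t (1 : R) F (sin (k * t)).
  rewrite /F; apply: is_derive_eq.
  by rewrite /GRing.scale /=; field.
rewrite /Rintegral (@continuous_FTC2 _ _ F)//.
- by rewrite -EFinB /= /F; field.
- apply: continuous_subspaceT => t.
  by apply: continuous_comp; [exact: mulrl_continuous|exact: continuous_sin].
- have cF : continuous F.
    by move=> t; apply/differentiable_continuous/derivable1_diffP; exact: ex_derive.
  by split; [move=> t _; exact: ex_derive|apply: cvg_at_right_filter|
    apply: cvg_at_left_filter]; exact: cF.
- by move=> t _; rewrite derive1E; exact: derive_val.
Qed.

(** The Fourier transform of the indicator of [[-r, r]]; the value at 0 is the length of the
    interval. *)
Definition sinc (r x : R) : R :=
  if x == 0 then 2 * r else sin (2 * pi * r * x) / (pi * x).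

(** Here [t] is the frequency and [x] the point of evaluation: integrating over [t] gives the
    inverse Fourier transform of the indicator of an interval. *)
Definition wave (c r x : R) (t : measurableTypeR R) : R[i] :=
  (\1_(`[c - r, c + r]%classic) t)%:C * cexpi (2 * pi * x * t).

Lemma cmod_wave c r x t : cmod (wave c r x t) = \1_(`[c - r, c + r]%classic) t.
Proof. by rewrite /wave cmodM cmod_cexpi mulr1 cmod_real ger0_norm. Qed.

Lemma Cmeasurable_wave c r x : Cmeasurable (wave c r x).
Proof.
apply: Cmeasurable_mul; last by apply: Cmeasurable_cexpi; exact: measurable_funM.
by split => /=; [exact: measurable_indic|exact: measurable_cst].
Qed.

Lemma Cintegrable_wave c r x : Cintegrable mu (wave c r x).
Proof.
apply: (Cintegrable_dominated (Cmeasurable_wave c r x) (integrable_indic_itv _ _ _ _)).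
by move=> t; rewrite cmod_wave; exact: lexx.
Qed.

Lemma Cintegral_wave c r x : 0 < r ->
  Cintegral mu (wave c r x) = cexpi (2 * pi * x * c) * (sinc r x)%:C.
Proof.
move=> r0; have crr : c - r < c + r by lra.
have -> : Cintegral mu (wave c r x) =
    (\int[mu]_(t in `[(c - r)%R, (c + r)%R]) cos (2 * pi * x * t))%R +i*
    (\int[mu]_(t in `[(c - r)%R, (c + r)%R]) sin (2 * pi * x * t))%R.
  congr (_ +i* _); rewrite [RHS]Rintegral_mkcond; apply: eq_Rintegral => t _;
    by rewrite /wave patchE /= indicE; case: ifP => _ /=;
      rewrite ?mul1r !mul0r ?subr0 ?addr0.
(* The antiderivatives divide by [2 * pi * x], so [x = 0], where the character is constant, is
   treated apart. *)
have [->|x0] := eqVneq x 0.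
  rewrite /sinc eqxx mulr0 mul0r cexpi0 mul1r.
  under eq_Rintegral do rewrite mul0r cos0.
  under [X in _ +i* X]eq_Rintegral do rewrite mul0r sin0.
  rewrite !Rintegral_cst//= mul0r mul1r lebesgue_measure_itv/= lte_fin crr.
  by rewrite -EFinB /=; congr (_ +i* _); ring.
have p0 : pi != 0 :> R by rewrite gt_eqF// pi_gt0.
have k0 : 2 * pi * x != 0 by rewrite !mulf_neq0.
rewrite Rintegral_cos// Rintegral_sin// /sinc (negbTE x0) /cexpi.
(* Expanding about the centre [c], the difference of endpoint values leaves twice the sine of
   [2 * pi * x * r] times the cosine, respectively sine, of [2 * pi * x * c]. *)
rewrite (mulrDr _ c r) (mulrBr _ c r) (cosD _ (2 * pi * x * r)).
rewrite (sinD _ (2 * pi * x * r)) (cosB _ (2 * pi * x * r)).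
rewrite (sinB _ (2 * pi * x * r)).
rewrite (_ : 2 * pi * r * x = 2 * pi * x * r); last by ring.
move: (sin (2 * pi * x * c)) (cos (2 * pi * x * c)) => S1 C1.
move: (sin (2 * pi * x * r)) (cos (2 * pi * x * r)) => S2 C2.
apply/eqP; rewrite eq_complex /=; apply/andP.
move: (pi : R) p0 {k0} => p p0.
by split; apply/eqP; field; rewrite x0 p0.
Qed.

Lemma abs_sin_le (x : R) : `|sin x| <= `|x|.
Proof.
wlog x0 : x / 0 <= x.
  move=> H; have [/H//|/ltW x0] := leP 0 x.
  by rewrite -(normrN x) -(normrN (sin x)) -sinN; apply: H; rewrite oppr_ge0.
have cs : {within `[0, x], continuous (@sin R)}.
  by apply: continuous_subspaceT; exact: continuous_sin.
have [c _] := MVT_segment x0 (fun y _ => is_derive_sin y) cs.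
rewrite sin0 !subr0 => ->; rewrite normrM ler_piMl//; exact: cos_max.
Qed.

(** Inversion is continuous only away from 0, so it is glued there with the conventional value 0. *)
Lemma measurable_fun_invr : measurable_fun setT (fun x : R => x^-1).
Proof.
rewrite (_ : (fun _ => _) = fun x : R => if x == 0 then 0 else x^-1); last first.
  by apply/funext => x; case: eqP => // ->; rewrite invr0.
apply: measurable_fun_if => //.
- exact: measurable_fun_eqr.
- rewrite setTI; apply: open_continuous_measurable_fun.
    rewrite (_ : _ @^-1` _ = [set x | x != 0]); first exact: open_neq.
    by apply/seteqP; split => x /=; case: eqP.
  move=> x; rewrite inE /= => /negP x0; apply: inv_continuous.
  exact/negP.
Qed.

Lemma measurable_sinc r : measurable_fun setT (sinc r).
Proof.
apply: measurable_fun_ifT => //=.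
- exact: measurable_fun_eqr.
- apply: measurable_funM.
    apply: measurableT_comp; last exact: measurable_funM.
    by apply: continuous_measurable_fun; exact: continuous_sin.
  by apply: measurableT_comp; [exact: measurable_fun_invr|exact: measurable_funM].
Qed.

(** The sum of two bounds: [sinc r x ^+ 2] is at most [(2 * r) ^+ 2] because [|sin y| <= |y|], and
    [x ^+ 2 * sinc r x ^+ 2] is at most [pi^-1 ^+ 2] because [|sin y| <= 1]. *)
Lemma sinc_le r x : 0 < r ->
  sinc r x ^+ 2 <= ((2 * r) ^+ 2 + (pi ^-1) ^+ 2) * (1 + x ^+ 2)^-1.
Proof.
move=> r0; rewrite -ler_pdivrMr ?invr_gt0 ?ltr_wpDr ?sqr_ge0// invrK.
have [->|x0] := eqVneq x 0.
  by rewrite /sinc eqxx expr0n addr0 mulr1 lerDl sqr_ge0.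
rewrite /sinc (negbTE x0).
have p0 : pi != 0 :> R by rewrite gt_eqF// pi_gt0.
rewrite mulrDr mulr1 lerD//.
  rewrite -ler_sqrt ?sqr_ge0// !sqrtr_sqr normrM normfV ler_pdivrMr; last first.
    by rewrite normr_gt0 mulf_neq0.
  rewrite -normrM (_ : 2 * r * (pi * x) = 2 * pi * r * x); first exact: abs_sin_le.
  by ring.
rewrite -exprMn (_ : _ / (_ * x) * x = sin (2 * pi * r * x) * pi^-1); last first.
  by rewrite invfM mulrA mulfVK.
by rewrite exprMn ler_piMl ?sqr_ge0// sin2cos2 gerBl sqr_ge0.
Qed.

Lemma integrable_oneDsqrV :
  mu.-integrable setT (EFin \o (fun x : R => (1 + x ^+ 2)^-1)).
Proof.
have c1 : continuous (fun x : R => (1 + x ^+ 2)^-1) by exact: continuous_oneDsqrV.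
have ge0 (x : R) : 0 <= (1 + x ^+ 2)^-1 by rewrite invr_ge0 addr_ge0 ?sqr_ge0.
apply/integrableP; split.
  by apply/measurable_EFinP; apply: continuous_measurable_fun.
under eq_integral do rewrite /= ger0_norm//.
rewrite ge0_symfun_integralT//; last by move=> x /=; rewrite sqrrN.
rewrite -set_itvcy (_ : integral _ _ _ = (pi / 2)%:E); last exact: integral0y_oneDsqr.
by rewrite -EFinM ltry.
Qed.

Lemma integrable_sqr_sinc r : 0 < r ->
  mu.-integrable setT (EFin \o (fun x => sinc r x ^+ 2)).
Proof.
move=> r0; set K := (2 * r) ^+ 2 + (pi ^-1) ^+ 2.
have iK : mu.-integrable setT (EFin \o (fun x : R => K * (1 + x ^+ 2)^-1)).
  rewrite (_ : _ \o _ = fun x => K%:E * ((1 + x ^+ 2)^-1)%:E)%E//.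
  by apply: integrableZl => //; exact: integrable_oneDsqrV.
apply: le_integrable iK => //.
  by apply/measurable_EFinP/measurable_funX; exact: measurable_sinc.
move=> x _; rewrite /= lee_fin ger0_norm ?sqr_ge0//.
by rewrite (le_trans (sinc_le x r0))// ler_norm.
Qed.

(** On the interval from 0 to [(2 * r)^-1] the argument of the sine lies strictly between 0 and
    [pi], so [sinc r] does not vanish there; a zero integral would make this interval a null set. *)
Lemma Rintegral_sqr_sinc_gt0 r : 0 < r -> (0 < \int[mu]_x (sinc r x ^+ 2))%R.
Proof.
move=> r0; rewrite lt_def Rintegral_ge0 ?andbT; last first.
  by move=> x _; exact: sqr_ge0.
apply/eqP => I0.
have ms : measurable_fun setT (fun x => (sinc r x ^+ 2)%:E).
  by apply/measurable_EFinP/measurable_funX; exact: measurable_sinc.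
have : (\int[mu]_x `|(sinc r x ^+ 2)%:E| = 0)%E.
  under eq_integral do rewrite gee0_abs ?lee_fin ?sqr_ge0//.
  rewrite -[LHS]fineK; first by congr EFin; exact: I0.
  by apply: integrable_fin_num => //; exact: integrable_sqr_sinc.
move=> /(ae_eq_integral_abs mu measurableT ms)[N [mN N0 subN]].
have : (mu `]0%R, ((2 * r)^-1)%R[ <= mu N)%E.
  apply: le_measure; rewrite ?inE//; apply: subset_trans subN.
  move=> x /=; rewrite in_itv/= => /andP[x0 xr] /(_ I) /eqP.
  rewrite eqe sqrf_eq0 /sinc (gt_eqF x0) mulf_eq0 invr_eq0 mulf_eq0.
  rewrite (gt_eqF x0) (gt_eqF (pi_gt0 R)) !orbF; apply/negP/lt0r_neq0.
  apply: sin_gt0_pi; rewrite !mulr_gt0 ?pi_gt0//=.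
  rewrite (_ : _ * x = pi * (x * (2 * r))); last by ring.
  by rewrite gtr_pMr ?pi_gt0// -ltr_pdivlMr ?mulr_gt0// mul1r.
rewrite N0 lebesgue_measure_itv/= lte_fin invr_gt0 mulr_gt0// -EFinB lee_fin.
by rewrite subr0 leNgt invr_gt0 mulr_gt0.
Qed.

End interval_transform.

(** * Real product integrals and integrability of Schwartz functions *)

Lemma continuous_measurable_rV (R : realType) n (p : 'rV[R]_n -> R) :
  continuous p -> measurable_fun setT p.
Proof.
move=> cp; apply: (measurability _ (RGenOpens.measurableE R)).
move=> _ [_ [a [b ->]] <-]; rewrite setTI; apply: open_measurable_rV.
by apply: open_comp => // x _; exact: cp.
Qed.

Section rV_product_real.
Variable R : realType.

(** The real part of the complex statement, applied to the [g i] seen as complex-valued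
    functions. *)
Lemma Rintegral_rV_prod n (g : 'I_n -> measurableTypeR R -> R) :
  (forall i, lebesgue_measure.-integrable setT (EFin \o g i)) ->
  (lebesgue_rV n).-integrable setT
    (fun x : 'rV[R]_n => (\prod_i g i (x ord0 i))%:E) /\
  (\int[lebesgue_rV n]_x \prod_i g i (x ord0 i) =
    \prod_i \int[lebesgue_measure]_t g i t)%R.
Proof.
move=> ig; have iu i : Cintegrable lebesgue_measure (fun t => (g i t)%:C).
  by split; [exact: ig|exact: integrable0].
have [[iR _] E] := Cintegral_rV_prod iu.
have prodE (x : 'rV[R]_n) :
    \prod_i (g i (x ord0 i))%:C = (\prod_i g i (x ord0 i))%:C.
  by rewrite (rmorph_prod (real_complex R)).
split.
  rewrite (_ : (fun _ => _) = fun x : 'rV[R]_n =>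
    (complex.Re (\prod_i (g i (x ord0 i))%:C))%:E)//.
  by apply/funext => x; rewrite prodE.
have := congr1 (@complex.Re R) E.
rewrite [LHS]/complex.Re /Cintegral; under eq_Rintegral do rewrite prodE /=.
move=> ->; rewrite (_ : \prod_i _ =
    (\prod_i \int[lebesgue_measure]_t g i t)%:C)//.
rewrite rmorph_prod; apply: eq_bigr => i _; rewrite /Cintegral /=.
by rewrite (Rintegral_cst lebesgue_measure measurableT) mul0r.
Qed.

End rV_product_real.

Section schwartz_integrable.
Context (R : realType) (d : nat).

Lemma cmpartial0 (f : 'rV[R]_d -> R[i]) (x : 'rV[R]_d) :
  cmpartial [ffun=> 0%N] f x = f x.
Proof.
have mp0 (p : 'rV[R]_d -> R) : mpartial [ffun=> 0%N] p = p.
  by rewrite /mpartial; elim: (enum 'I_d) => //= i s ->; rewrite ffunE.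
by rewrite /cmpartial !mp0; case: (f x).
Qed.

Lemma schwartz_measurable (h : 'rV[R]_d -> R[i]) : schwartz h -> Cmeasurable h.
Proof.
by move=> [[sR sI] _]; split; apply: continuous_measurable_rV;
  [have [] := sR [::]|have [] := sI [::]].
Qed.

(** Writes the weight as a finite sum of monomials, each of which is controlled by one Schwartz
    bound; [f] selects the coordinates with exponent 2. *)
Lemma prod_1Dsqr (x : 'rV[R]_d) : \prod_i (1 + x ord0 i ^+ 2) =
  \sum_(f : {ffun 'I_d -> bool}) mpow x [ffun i => (f i).*2].
Proof.
rewrite [RHS](_ : _ = \sum_(f : {ffun 'I_d -> bool})
    \prod_i x ord0 i ^+ (f i).*2); last first.
  by apply: eq_bigr => f _; apply: eq_bigr => i _; rewrite ffunE.
rewrite -(bigA_distr_bigA (fun i (b : bool) => x ord0 i ^+ b.*2)).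
by apply: eq_bigr => i _; rewrite big_bool /= addrC.
Qed.

(** The Schwartz bounds without derivatives dominate [cmod (h x)] by a constant times the product of
    the [(1 + x_i ^+ 2)^-1]. This product weight is integrable because its integral factorises into
    one-dimensional ones. *)
Lemma schwartz_Cintegrable (h : 'rV[R]_d -> R[i]) :
  schwartz h -> Cintegrable (lebesgue_rV d) h.
Proof.
move=> sh; have mh := schwartz_measurable sh.
have [C hC] : exists C : R, forall x : 'rV[R]_d,
    \prod_i (1 + x ord0 i ^+ 2) * cmod (h x) <= C.
  have /choice[C hC] : forall f : {ffun 'I_d -> bool}, exists C : R,
      forall x, `|mpow x [ffun i => (f i).*2]| * cmod (h x) <= C.
    move=> f; have [C hC] := sh.2 [ffun i => (f i).*2] [ffun=> 0%N].
    by exists C => x; have := hC x; rewrite cmpartial0.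
  exists (\sum_f C f) => x; rewrite prod_1Dsqr mulr_suml; apply: ler_sum => f _.
  by apply: le_trans (hC f x); rewrite ler_wpM2r ?cmod_ge0// ler_norm.
have [ip _] := @Rintegral_rV_prod R d (fun=> fun t => (1 + t ^+ 2)^-1)
  (fun=> integrable_oneDsqrV R).
have iC : (lebesgue_rV d).-integrable setT
    (EFin \o (fun x : 'rV[R]_d => C * \prod_i (1 + x ord0 i ^+ 2)^-1)).
  rewrite (_ : _ \o _ = fun x : 'rV[R]_d =>
    (C%:E * (\prod_i (1 + x ord0 i ^+ 2)^-1)%:E)%E)//.
  exact: integrableZl.
apply: Cintegrable_dominated mh iC _ => x.
have p0 : 0 < \prod_i (1 + x ord0 i ^+ 2).
  by apply: prodr_gt0 => i _; rewrite ltr_wpDr ?sqr_ge0.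
by rewrite prodfV -ler_pdivrMr ?invr_gt0// invrK mulrC.
Qed.

End schwartz_integrable.

(** * A square-integrable function whose Fourier transform is the indicator of a cube *)

Section bandlimited.
Context (R : realType) (d : nat) (c : 'rV[R]_d) (r : R).
Hypothesis r0 : 0 < r.
Implicit Types x xi : 'rV[R]_d.

(** The character [xi |-> cexpi (2 * pi * dot x xi)] cut off to the closed cube of centre [c] and
    half-side [r], written as a product so that its integral over [xi] factorises. *)
Definition box_wave x xi : R[i] := \prod_j wave (c ord0 j) r (x ord0 j) (xi ord0 j).

(** The inverse Fourier transform of the indicator of that cube, in closed form. *)
Definition box_sinc x : R[i] :=
  \prod_j (cexpi (2 * pi * x ord0 j * c ord0 j) * (sinc r (x ord0 j))%:C).

Lemma Cintegrable_box_wave x : Cintegrable (lebesgue_rV d) (box_wave x).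
Proof.
exact: (Cintegral_rV_prod (fun j => Cintegrable_wave (c ord0 j) r (x ord0 j))).1.
Qed.

Lemma Cintegral_box_wave x : Cintegral (lebesgue_rV d) (box_wave x) = box_sinc x.
Proof.
rewrite (Cintegral_rV_prod
  (fun j => Cintegrable_wave (c ord0 j) r (x ord0 j))).2.
by apply: eq_bigr => j _; rewrite Cintegral_wave.
Qed.

Lemma cmod_box_wave x xi : cmod (box_wave x xi) =
  \prod_j \1_(`[c ord0 j - r, c ord0 j + r]%classic) (xi ord0 j).
Proof. by rewrite cmod_prod; apply: eq_bigr => j _; rewrite cmod_wave. Qed.

Lemma box_wave_in x xi : (forall j, `|xi ord0 j - c ord0 j| <= r) ->
  box_wave x xi = cexpi (2 * pi * dot x xi).
Proof.
move=> xir; rewrite /dot mulr_sumr cexpi_sum; apply: eq_bigr => j _.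
rewrite /wave indicE mem_set; last first.
  by rewrite /= in_itv/=; have := xir j; rewrite ler_norml; lra.
by rewrite mul1r mulrA.
Qed.

Lemma box_wave_out x xi : ~ (forall j, `|xi ord0 j - c ord0 j| <= r) ->
  box_wave x xi = 0.
Proof.
move=> /existsNP[j /negP xij].
rewrite /box_wave (bigD1 j)//= /wave indicE memNset ?mul0r//=.
rewrite in_itv/= => xjr; case/negP: xij; rewrite ler_norml; lra.
Qed.

Lemma sqr_cmod_box_sinc x : cmod (box_sinc x) ^+ 2 = \prod_j sinc r (x ord0 j) ^+ 2.
Proof.
rewrite cmod_prod -prodrXl; apply: eq_bigr => j _.
by rewrite cmodM cmod_cexpi mul1r cmod_real real_normK ?num_real.
Qed.

Lemma Cmeasurable_box_sinc : Cmeasurable box_sinc.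
Proof.
apply: (@Cmeasurable_rV_prod _ _
  (fun j t => cexpi (2 * pi * t * c ord0 j) * (sinc r t)%:C)) => j.
apply: Cmeasurable_mul; last first.
  by split; [exact: measurable_sinc|exact: measurable_cst].
apply: Cmeasurable_cexpi; apply: measurable_funM => //; exact: measurable_funM.
Qed.

(** The unimodular factors drop out of the modulus, which leaves a product over the coordinates. The
    value shows that the norm is finite and positive. *)
Lemma sqnorm2_box_sinc :
  sqnorm2 box_sinc = ((\int[lebesgue_measure]_t (sinc r t ^+ 2))%R ^+ d)%:E.
Proof.
rewrite /sqnorm2; under eq_integral do rewrite sqr_cmod_box_sinc.
have [ip E] := @Rintegral_rV_prod R d (fun=> fun t => sinc r t ^+ 2)
  (fun=> integrable_sqr_sinc r0).
rewrite prodr_const card_ord in E; rewrite -E /Rintegral fineK//.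
exact: integrable_fin_num.
Qed.

Lemma L2_box_sinc : L2 box_sinc.
Proof.
have [mR mI] := Cmeasurable_box_sinc.
by split => //; rewrite sqnorm2_box_sinc ltry.
Qed.

Lemma sqnorm2_box_sinc_gt0 : (0 < sqnorm2 box_sinc)%E.
Proof. by rewrite sqnorm2_box_sinc lte_fin exprn_gt0// Rintegral_sqr_sinc_gt0. Qed.

Lemma Cmeasurable_box_wave2 :
  Cmeasurable (fun z : 'rV[R]_d * 'rV[R]_d => box_wave z.1 z.2).
Proof.
apply: Cmeasurable_prod => j.
have m1 : measurable_fun setT
    (fun z : 'rV[R]_d * 'rV[R]_d => z.1 ord0 j : measurableTypeR R).
  exact: (measurableT_comp (measurable_coord j)).
have m2 : measurable_fun setT
    (fun z : 'rV[R]_d * 'rV[R]_d => z.2 ord0 j : measurableTypeR R).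
  exact: (measurableT_comp (measurable_coord j)).
apply: Cmeasurable_mul.
  split; last exact: measurable_cst.
  by apply: (measurableT_comp _ m2); exact: measurable_indic.
by apply: Cmeasurable_cexpi; do 2 apply: measurable_funM => //.
Qed.

(** An instance of Parseval's identity: after exchanging the integrals, the inner product becomes
    the integral over the cube of the conjugate of [fourier k]. *)
Lemma inner2_box_sinc (k : 'rV[R]_d -> R[i]) : Cintegrable (lebesgue_rV d) k ->
  (forall xi, (forall j, `|xi ord0 j - c ord0 j| <= r) -> fourier k xi = 0) ->
  inner2 box_sinc k = 0.
Proof.
move=> ik k0; have mk := Cintegrable_Cmeasurable ik.
pose G (z : 'rV[R]_d * 'rV[R]_d) := conjc (k z.1) * box_wave z.1 z.2.
have mG : Cmeasurable G.
  apply: Cmeasurable_mul; last exact: Cmeasurable_box_wave2.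
  apply: Cmeasurable_conj; have [mR mI] := mk.
  by split; [apply: (measurableT_comp mR)|apply: (measurableT_comp mI)];
    exact: measurable_fst.
have [iq _] := @Rintegral_rV_prod R d
  (fun j => \1_(`[c ord0 j - r, c ord0 j + r]%classic))
  (fun j => integrable_indic_itv _ _ _ _).
rewrite -[LHS]/(Cintegral (lebesgue_rV d) (fun x => box_sinc x * conjc (k x))).
transitivity (Cintegral (lebesgue_rV d) (fun x =>
    Cintegral (lebesgue_rV d) (fun xi => G (x, xi)))).
  congr Cintegral; apply/funext => x.
  rewrite (CintegralZl (conjc (k x)) (Cintegrable_box_wave x)).
  by rewrite Cintegral_box_wave mulrC.
(* The exchange is dominated by [|Re k| + |Im k|] in [x] times the indicator of the cube in [xi]. *)
rewrite (Cintegral_swap (Cintegrable_cmod ik) iq mG); last first.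
  move=> x xi; rewrite cmodM cmod_conj /= cmod_box_wave.
  apply: ler_pM; rewrite ?cmod_ge0 ?ler_norm//.
    by apply: prodr_ge0.
  exact: le_trans (le_cmod_ReIm _) (ler_norm _).
have -> : (fun xi => Cintegral (lebesgue_rV d) (fun x => G (x, xi))) = fun=> 0.
  apply/funext => xi; rewrite /G /=.
  have [xiB|xiB] := pselect (forall j, `|xi ord0 j - c ord0 j| <= r); last first.
    under [in LHS]eq_fun do rewrite box_wave_out// mulr0.
    by rewrite /Cintegral !(Rintegral_cst _ measurableT) mul0r.
  (* On the cube, [conjc (k x)] times the character is the conjugate of the integrand of
     [fourier k xi]. *)
  under [in LHS]eq_fun do rewrite box_wave_in// -[cexpi _]conjcK -cexpiN -rmorphM.
  rewrite Cintegral_conj; first by rewrite -[Cintegral _ _]/(fourier k xi) k0// conjc0.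
  apply: (Cintegrable_dominated _ (Cintegrable_cmod ik)).
    apply: Cmeasurable_mul => //; apply: Cmeasurable_cexpi.
    apply: measurableT_comp => //; apply: measurable_funM => //.
    apply: measurable_sum => j; apply: measurable_funM => //.
    exact: measurable_coord.
  by move=> x; rewrite cmodM cmod_cexpi mulr1 le_cmod_ReIm.
by rewrite /Cintegral !(Rintegral_cst _ measurableT) mul0r.
Qed.

End bandlimited.

(** Used to see that the transform of an atom vanishes wherever that of its generator does. The
    proof translates the integrand of [fourier h xi] and absorbs the phase. *)
Lemma fourier_shift (R : realType) (d : nat) (h : 'rV[R]_d -> R[i])
    (c xi : 'rV[R]_d) : Cintegrable (lebesgue_rV d) h ->
  fourier (fun x => h (x - c)) xi = cexpi (- (2 * pi * dot c xi)) * fourier h xi.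
Proof.
move=> ih.
pose e x := h x * cexpi (- (2 * pi * dot x xi)).
have ie : Cintegrable (lebesgue_rV d) e.
  apply: (Cintegrable_dominated _ (Cintegrable_cmod ih)).
    apply: Cmeasurable_mul; first exact: Cintegrable_Cmeasurable ih.
    apply: Cmeasurable_cexpi; apply: measurableT_comp => //.
    apply: measurable_funM => //; apply: measurable_sum => j.
    by apply: measurable_funM => //; exact: measurable_coord.
  by move=> x; rewrite cmodM cmod_cexpi mulr1 le_cmod_ReIm.
rewrite -[fourier h xi]/(Cintegral (lebesgue_rV d) e) -(Cintegral_shift (- c) ie).
rewrite -CintegralZl; last exact: Cintegrable_shift.
rewrite -[LHS]/(Cintegral (lebesgue_rV d)
  (fun x => h (x - c) * cexpi (- (2 * pi * dot x xi)))).
congr Cintegral; apply/funext => x; rewrite /e mulrCA -cexpiD; congr (_ * cexpi _).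
rewrite -opprD -mulrDr; congr (- (_ * _)); rewrite /dot -big_split /=.
by apply: eq_bigr => j _; rewrite !mxE; ring.
Qed.

(** * The enlarged support cubes cover the frequency space *)

Section nsgf_covering.
Context (R : realType) (d : nat).
Variables (h : 'rV[int]_d -> 'rV[R]_d -> R[i]) (a : 'rV[int]_d -> R)
  (b : 'rV[int]_d -> 'rV[R]_d) (Cstar : R).
Hypothesis H : painless_nsgf h a b Cstar.

Lemma nsgf_step_ub : exists S : R, 0 < S /\ forall m, a m <= S.
Proof.
have a0 := nsgf_step_gt0 H; have := nsgf_step_bounded H.
set s := ereal_sup _ => soo.
have as_ m : ((a m)%:E <= s)%E by apply: ereal_sup_ubound; exists m.
have sE : s = (fine s)%:E.
  (* The index 0 shows that the supremum is not [-oo]. *)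
  rewrite fineK// fin_numElt soo andbT.
  by apply: lt_le_trans (as_ 0); rewrite ltNyr.
exists (fine s); split => [|m].
  by apply: lt_le_trans (a0 0) _; rewrite -lee_fin -sE.
by rewrite -lee_fin -sE.
Qed.

Lemma nsgf_frame_cover (x : 'rV[R]_d) : exists m, forall j,
  - (nsgf_eps a Cstar m / 2) + b m ord0 j < x ord0 j <
    (a m)^-1 + nsgf_eps a Cstar m / 2 + b m ord0 j.
Proof.
apply: contrapT => /forallNP xN.
have [S [S0 aS]] := nsgf_step_ub; have C0 := nsgf_Cstar_gt0 H.
have a0 := nsgf_step_gt0 H.
(* Every [eps_m] is at least [Cstar / S], so [r < eps_m / 2] uniformly in [m]. A support cube
   meeting the cube of half-side [r] about [x] would then contain [x] after enlargement by
   [eps_m / 2]. *)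
pose r := Cstar / S / 4.
have r0 : 0 < r by rewrite !divr_gt0.
have r_eps m : r < nsgf_eps a Cstar m / 2.
  have : Cstar / S <= nsgf_eps a Cstar m.
    by rewrite ler_pM2l// lef_pV2 ?posrE.
  by have : 0 < Cstar / S by [exact: divr_gt0]; rewrite /r; lra.
(* The lower frame inequality for [box_sinc x r] is kept as the goal's premise; all its coefficients
   will be zero while its norm is positive. *)
have [C1 [C2 [C10 _ /(_ _ (L2_box_sinc x r0))[+ _]]]] := nsgf_frame H.
have atom0 mn : inner2 (box_sinc x r) (nsgf_atom h a mn) = 0.
  have ih := schwartz_Cintegrable (nsgf_schwartz H mn.1).
  apply: inner2_box_sinc => //.
    exact: (Cintegrable_shift (- (a mn.1 *: map_mx intr mn.2)) ih).
  move=> xi xir; rewrite (fourier_shift _ _ ih).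
  apply: contrapT => /eqP; rewrite mulf_eq0 negb_or => /andP[_ hxi].
  have /(nsgf_supp H) /= xib : supp (fourier (h mn.1)) xi by exact: subset_closure.
  apply: (xN mn.1) => j; have := xib j; have := xir j; rewrite ler_norml.
  by have := r_eps mn.1; lra.
rewrite esum1; last first.
  by move=> mn _; rewrite atom0 /cmod ComplexField.Normc.normc0 expr0n.
by rewrite leNgt mule_gt0 ?lte_fin ?sqnorm2_box_sinc_gt0.
Qed.

End nsgf_covering.

(** * Scalar matrices, and cubes under scalings and translations *)

Lemma mx_norm_scalar_le (R : realType) (d : nat) (k : R) :
  mx_norm (k%:M : 'M[R]_d) <= `|k|.
Proof.
rewrite mx_normE -[leRHS]nngE num_le; apply/bigmax_leP; split=> [|[i j] _].
  exact: normr_ge0.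
by rewrite -num_le /= mxE; case: eqP => // _; rewrite mulr0n normr0.
Qed.

Section box.
Context (R : realType) (d : nat).

(** One family for both sets of the covering: [box 0] is [Q], and a small positive [e] gives [P]. *)
Definition box (e : R) : set 'rV[R]_d := [set x | forall j, e < x ord0 j < 1 - e].

(** Balls of the sup norm are cubes; openness of [box e] follows. *)
Lemma box_ball e : e < 2^-1 -> box e = ball (const_mx 2^-1 : 'rV[R]_d) (2^-1 - e).
Proof.
move=> e2; apply/seteqP; split => x /=.
  move=> xe; split; first by rewrite subr_gt0.
  move=> i j; rewrite (ord1 i) mxE /ball/= ltr_norml; have := xe j; lra.
move=> [_ xe] j; have := xe ord0 j; rewrite mxE /ball/= ltr_norml; lra.
Qed.

Lemma open_box e : e < 2^-1 -> open (box e).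
Proof. by move=> e2; rewrite box_ball//; apply: ball_open; rewrite subr_gt0. Qed.

Lemma compact_cbox (u v : R) :
  compact [set x : 'rV[R]_d | forall j, `[u, v]%classic (x ord0 j)].
Proof.
exact: (@rV_compact R d (fun=> `[u, v]%classic) (fun=> @segment_compact R u v)).
Qed.

Lemma bounded_box e : 0 <= e -> bounded_set (box e).
Proof.
move=> e0; have := compact_bounded (@compact_cbox 0 1).
rewrite /bounded_near /=; apply: filterS => M HM x /= xe; apply: HM => j.
by rewrite in_itv/=; have := xe j; lra.
Qed.

(** The closure stays in the cube [[e, 1 - e]^d], which is compact and lies inside the open unit
    cube. *)
Lemma compactly_contained_box e : 0 < e -> e < 2^-1 ->
  compactly_contained (box e) (box 0).
Proof.
move=> e0 e2.
have sub : closure (box e) `<=` [set x | forall j, `[e, 1 - e]%classic (x ord0 j)].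
  have cK : closed [set x : 'rV[R]_d | forall j, `[e, 1 - e]%classic (x ord0 j)].
    by apply: compact_closed; [exact: norm_hausdorff|exact: compact_cbox].
  rewrite [X in _ `<=` X](closure_id _).1//; apply: closure_subset => x /= xe j.
  by rewrite in_itv/=; have := xe j; lra.
split.
- by exists (const_mx 2^-1) => j; rewrite mxE; lra.
- exact: open_box.
- by apply: open_box; rewrite invr_gt0.
- by move=> x /sub xe j; have := xe j; rewrite /= in_itv/=; lra.
- apply: subclosed_compact sub; first exact: closed_closure.
  exact: compact_cbox.
Qed.

End box.

Lemma aimage_scalar_box (R : realType) (d : nat) (s e : R) (c : 'rV[R]_d) :
  0 < s -> aimage (s *: 1%:M, c) (box e) =
  [set y : 'rV[R]_d | forall j, s * e + c ord0 j < y ord0 j < s * (1 - e) + c ord0 j].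
Proof.
move=> s0.
have aE (x : 'rV[R]_d) j :
    affine_map (s *: 1%:M, c) x ord0 j = s * x ord0 j + c ord0 j.
  by rewrite /affine_map /= linearZ /= trmx1 -scalemxAr mulmx1 !mxE.
apply/seteqP; split => [_ [x xe <-] j|y ye].
  by rewrite aE !ltrD2r !ltr_pM2l.
have s1 : s * s^-1 = 1 by rewrite divff ?gt_eqF.
exists (s^-1 *: (y - c)) => [j|].
  rewrite !mxE mulrC ltr_pdivlMr// ltr_pdivrMr// mulrC [X in _ && (_ < X)]mulrC.
  by have := ye j; lra.
by apply/rowP => j; rewrite aE !mxE mulrA s1 mul1r subrK.
Qed.

(** * Verification of the clauses of a structured covering *)

Unset Implicit Arguments.
Set Strict Implicit.
Theorem lemma4p1 (R : realType) (d : nat) (d_gt0 : (0 < d)%N)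
    (h : 'rV[int]_d -> 'rV[R]_d -> R[i]) (a : 'rV[int]_d -> R)
    (b : 'rV[int]_d -> 'rV[R]_d) (Cstar : R) :
  painless_nsgf h a b Cstar ->
  let eps m := Cstar / a m in
  let Q := [set x : 'rV[R]_d | forall j, 0 < x ord0 j < 1] in
  let A m : 'M[R]_d := (2 * eps m + 1 / a m) *: 1%:M in
  let c m : 'rV[R]_d := \row_(j < d) (- eps m + b m ord0 j) in
  let Ts := [set (A m, c m) | m in [set: 'rV[int]_d]] in
  structured_covering Ts Q.
Proof.
move=> H eps Q A c Ts.
have C0 := nsgf_Cstar_gt0 H; have a0 := nsgf_step_gt0 H.
(* The m-th cube has side [s m = K / a m], so [eps m] is the fixed fraction [Cstar / K] of the
   side. *)
pose K := 2 * Cstar + 1; have K0 : 0 < K by rewrite /K; lra.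
pose s m := 2 * eps m + 1 / a m.
have sE m : s m = K / a m by rewrite /s /eps /K mulrA -mulrDl.
have s0 m : 0 < s m by rewrite sE divr_gt0.
have sKE m : eps m = s m * (Cstar / K).
  by rewrite sE /eps; field; rewrite !gt_eqF.
have sKV m : s m = (a m)^-1 + 2 * eps m by rewrite /s div1r addrC.
have QE : Q = box 0.
  by apply/seteqP; split => x xe j; have := xe j; rewrite subr0.
have imQ m : aimage (A m, c m) Q = nsgf_cube a b Cstar m.
  rewrite QE (aimage_scalar_box 0 (c m) (s0 m)) mulr0 subr0 mulr1 sKV.
  apply/seteqP; split => x xe j; have := xe j;
    by rewrite /nsgf_eps mxE -/(eps m); lra.
(* With this [e] the affine map trims [eps m / 2] off each face of the m-th cube, which leaves the
   support cube enlarged by [eps m / 2]. Since [Cstar < K], [e] is below one half. *)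
pose e := Cstar / K / 2.
have e0 : 0 < e by rewrite !divr_gt0.
have e2 : e < 2^-1.
  by rewrite /e -[ltRHS]mul1r ltr_pM2r ?invr_gt0// ltr_pdivrMr// /K; lra.
have PQ : box e `<=` Q by move=> x xe j; have := xe j; lra.
have QK m m' : aimage (A m', c m') Q `&` aimage (A m, c m) Q !=set0 ->
    nsgf_neighbours a b Cstar m m' by rewrite !imQ.
have covP : \bigcup_(T in Ts) aimage T (box e) = setT.
  apply/seteqP; split => // x _; have [m mx] := nsgf_frame_cover H x.
  exists (A m, c m); first by exists m.
  rewrite (aimage_scalar_box e (c m) (s0 m)) => j; have := mx j.
  rewrite /nsgf_eps mxE -/(eps m).
  have se : s m * e = eps m / 2 by rewrite /e mulrA -sKE.
  rewrite mulrBr mulr1 se sKV; lra.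
have subP T : aimage T (box e) `<=` aimage T Q by exact: image_subset.
have [n0 hn0] := nsgf_overlap H.
have nbQ T : Ts T -> (neighbours Ts Q T #<= `I_n0)%card.
  move=> [m _ <-].
  (* Neighbouring maps come from neighbouring indices, and passing from indices to maps cannot
     increase the count. *)
  apply: (@card_le_trans _ _ _ [set (A m', c m') | m' in nsgf_neighbours a b Cstar m]).
    by apply: subset_card_le => _ [[m' _ <-] /QK mm']; exists m'.
  exact: card_le_trans (card_image_le _ _) (hn0 m).
(* The points must be functions of the map [T], not of [m]. A diagonal entry of [T.1] gives the
   side, hence [eps m], and adding it to the translation part recovers [b m]. *)
have i0 : 'I_d by exact: Ordinal d_gt0.
pose xi (T : 'M[R]_d * 'rV[R]_d) : 'rV[R]_d :=
  \row_j (T.1 i0 i0 * (Cstar / K) + T.2 ord0 j).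
have xiE m : xi (A m, c m) = b m.
  apply/rowP => j; rewrite !mxE eqxx mulr1 -/(s m) -sKE; ring.
split.
- split; first by apply: sub_countable (card_image_le _ _) _; exact: countableP.
  move=> _ [m _ <-] /=; rewrite /A scalemx1 unitmxE det_scalar unitfE.
  by apply: expf_neq0; exact/lt0r_neq0/s0.
- by rewrite QE; exact: bounded_box.
- by rewrite QE; apply: open_box; rewrite invr_gt0.
exists (box e); split.
- exact: bounded_box (ltW e0).
- exact: open_box.
- exact: PQ.
- by rewrite QE; exact: compactly_contained_box.
split.
- split; split.
  + exact: covP.
  + exists n0 => T TsT; apply: card_le_trans (nbQ T TsT).
    apply: subset_card_le => T' [TsT' [y [y1 y2]]]; split => //.
    by exists y; split; exact: subP.
  + apply/seteqP; split => // x _.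
    have : setT x by []; rewrite -covP => -[T TsT Tx].
    by exists T => //; exact: subP.
  + by exists n0.
- have [C1 [C2 [C10 C20 hC]]] := nsgf_step_equiv H.
  (* The product of the inverse of [A m'] with [A m] is the scalar matrix of [a m' / a m], which the
     step equivalence bounds by [C2]. *)
  exists C2; split => // _ _ [m _ <-] [m' _ <-] /QK mm' /=.
  rewrite /A !scalemx1 invmx_scalar -scalar_mxM.
  apply: le_trans (mx_norm_scalar_le _ _) _.
  rewrite -/(s m) -/(s m') !sE ger0_norm.
    rewrite (_ : (K / a m')^-1 * (K / a m) = a m' / a m); last first.
      by field; rewrite !gt_eqF.
    by rewrite ler_pdivrMr//; have /andP[] := hC _ _ mm'.
  by rewrite mulr_ge0 ?invr_ge0 ?divr_ge0// ltW.
- have [S [S0 aS]] := nsgf_step_ub H.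
  (* The inverse of [A m] is the scalar matrix of [a m / K], and [S] bounds the steps. *)
  exists (S / K); split; first by rewrite divr_gt0.
  move=> _ [m _ <-] /=; rewrite /A scalemx1 invmx_scalar.
  apply: le_trans (mx_norm_scalar_le _ _) _.
  rewrite -/(s m) sE invf_div ger0_norm; last by rewrite divr_ge0 ?ltW.
  by rewrite ler_pM2r ?invr_gt0.
exists xi; split.
- have [delta [delta0 sepE]] := nsgf_separated H.
  (* Positive separation makes [b] injective, so distinct indices give distinct maps. The two infima
     are then over the same set of distances. *)
  have binj m m' : b m = b m' -> m = m'.
    move=> bb; apply: contrapT => mm'.
    have : (delta%:E <= (norm2 (b m - b m'))%:E)%E.
      by rewrite -sepE; apply: ereal_inf_lbound; exists m, m'.
    rewrite bb subrr /norm2 big1 ?sqrtr0 ?lee_fin ?leNgt ?delta0//.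
    by move=> i _; rewrite mxE expr0n.
  exists delta; split => //; rewrite -sepE; congr ereal_inf; apply/seteqP.
  split=> [_ [_ [_ [[m _ <-] [m' _ <-] TT' ->]]]|_ [m [m' [_ _ mm' ->]]]].
    by rewrite !xiE; exists m, m'; split => // mm'; apply: TT'; rewrite mm'.
  exists (A m, c m), (A m', c m'); rewrite !xiE; split => //.
  + by exists m.
  + by exists m'.
  + by move=> TT'; apply/mm'/binj; rewrite -!xiE TT'.
- move=> _ [m _ <-]; rewrite imQ xiE => j; rewrite /nsgf_eps -/(eps m).
  have : 0 < eps m by rewrite divr_gt0.
  have : 0 < (a m)^-1 by rewrite invr_gt0.
  lra.
- have [C [C_gt0 hC]] := nsgf_moderate H.
  exists C; split => // _ [m _ <-] x y; rewrite imQ; exact: hC.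
- have [gamma [gamma0 hg]] := nsgf_volume H.
  by exists gamma; split => // _ [m _ <-]; rewrite imQ xiE.
Qed.
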